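(* Let $f(z)=\sum_{n=0}^\infty a_{2n+1}z^{2n+1}$ and $g(z)=\sum_{n=0}^\infty b_{2n+1}z^{2n+1}$ be two odd analytic functions defined in $\mathbb{D}$ such that $|g(z)|\leq |f(z)|$ for all $z\in\mathbb{D}$. Then $\mathcal{M}_g(r)\leq \mathcal{M}_f(r)$ for all $r=|z|\leq 1/\sqrt{3}$. This radius $1/\sqrt{3}$ is the best possible: for every $r\in(1/\sqrt{3},1)$ there are odd analytic functions $f,g$ in $\mathbb{D}$ with $|g(z)|\le|f(z)|$ for all $z\in\mathbb{D}$ and $\mathcal{M}_g(r)>\mathcal{M}_f(r)$.
   Context: $\mathbb{D}$ denotes the open unit disk in $\mathbb{C}$. For a complex valued analytic function $F(z)=\sum_{n=0}^\infty A_nz^n$ in $\mathbb{D}$, its majorant series is $\mathcal{M}_F(r):=\sum_{n=0}^\infty |A_n|r^n$ for $0\le r<1$. *)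

(* Defs.v *)
From Stdlib Require Import Reals.
From Coquelicot Require Import Coquelicot.
Open Scope R_scope.

(** [analytic_in_disk F A]: [F] is analytic in the open unit disk, with Taylor
    coefficients [A] at the origin (these are uniquely determined by [F]).
    Values of [F] outside the disk are unconstrained. *)
Definition analytic_in_disk (F : C -> C) (A : nat -> C) : Prop :=
  forall z : C, Cmod z < 1 ->
    @is_pseries C_AbsRing C_NormedModule A z (F z).

Definition odd_in_disk (F : C -> C) : Prop :=
  forall z : C, Cmod z < 1 -> F (Copp z) = Copp (F z).

Definition dominated_in_disk (g f : C -> C) : Prop :=
  forall z : C, Cmod z < 1 -> Cmod (g z) <= Cmod (f z).

(** The majorant series of the function with Taylor coefficients [A].  The
    total operator [PSeries] is meaningful here: when the expansion converges
    on the whole disk, the majorant series converges for [0 <= r < 1]. *)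
Definition majorant_series (A : nat -> C) (r : R) : R :=
  PSeries (fun n => Cmod (A n)) r.

(* Main.v *)
Require Import Defs.
From Stdlib Require Import Reals Lra Lia Classical.
From Coquelicot Require Import Coquelicot.
Open Scope R_scope.

(** Write f(z) = z F(z^2) and g(z) = z G(z^2). Every w in the disk is a square,
    so |G| <= |F| in the disk, and M_f(r) = r M_F(r^2), M_g(r) = r M_G(r^2). It
    therefore suffices to compare M_G and M_F on [0, 1/3]
    ([majorant_le_of_dominated]). Removing a power of z, let F(0) <> 0. The
    quotient phi = G/F is then a formal power series with coefficients c_k, and
    since M_G <= M_phi M_F termwise, what is needed is M_phi(r) <= 1 for
    r <= 1/3. This is Bohr's inequality
      |c_0| + sum_(k >= 1) |c_k| r^k <= |c_0| + (1 - |c_0|^2) / 2 <= 1,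
    which rests on |c_k| <= 1 - |c_0|^2 for k >= 1 ([quotient_coef_bound]).

    That coefficient bound would be classical if phi were known to be analytic
    in the whole disk. The proof uses no Cauchy theory: it works with absolutely
    summable coefficient sequences on the closed unit disk and with Parseval's
    identity over roots of unity. The tool is [multiplier_contraction]: if the
    sum of x is bounded by q on the unit circle, then convolution by x has norm
    at most q on square-summable sequences, even after truncation. Applied to a
    vector supported on {0, k}, it gives |c_k| <= 1 - |c_0|^2 for a summable
    series of modulus at most 1 ([schwarz_pick_coef]).

    The coefficients of phi have to be shown summable on smaller circles.
    - If F has no zero in |z| <= t, the formal inverse of F is summable at every
      radius below t ([inverse_summable]). For s near r, the identity
      1/F(rz) = 1/F(sz) + ((F(sz) - F(rz)) / F(sz)) (1/F(rz)) has a contraction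
      in front of the last factor, so that summability at s gives boundedness of
      the coefficients at r, with a step |r - s| that does not depend on s.
    - A zero w of F is also a zero of G. Dividing both by the Blaschke factor of
      w keeps phi, the domination and the bound of |F| on the unit circle, but
      multiplies |F(0)| by 1/|w|. As |F(0)| cannot exceed that bound, only
      finitely many divisions are possible in |z| <= t
      ([coef_bound_by_zero_removal]).

    For sharpness take f(z) = z and g(z) = z (al - z^2) / (1 - al z^2): then
    M_g(r) / r = al + (1 - al^2) r^2 / (1 - al r^2), which exceeds 1 as soon as
    (1 + 2 al) r^2 > 1, and al < 1 can be chosen so when 3 r^2 > 1. *)

(** * Finite sums *)

(** Sums over indices strictly below [N]. Having the empty sum as base case keeps the
    inductions below free of index shifts. *)
Fixpoint rsum (u : nat -> R) (N : nat) : R :=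
  match N with O => 0 | S n => rsum u n + u n end.

Fixpoint csum (u : nat -> C) (N : nat) : C :=
  match N with O => RtoC 0 | S n => (csum u n + u n)%C end.

Definition tail {T : Type} (u : nat -> T) : nat -> T := fun n => u (S n).

Lemma rsum_ext u v N :
  (forall n, (n < N)%nat -> u n = v n) -> rsum u N = rsum v N.
Proof.
  induction N as [|N IH]; intros H; simpl; [reflexivity|].
  rewrite IH by (intros; apply H; lia). rewrite H by lia. reflexivity.
Qed.

Lemma csum_ext u v N :
  (forall n, (n < N)%nat -> u n = v n) -> csum u N = csum v N.
Proof.
  induction N as [|N IH]; intros H; simpl; [reflexivity|].
  rewrite IH by (intros; apply H; lia). rewrite H by lia. reflexivity.
Qed.

Lemma rsum_le u v N :
  (forall n, (n < N)%nat -> u n <= v n) -> rsum u N <= rsum v N.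
Proof.
  induction N as [|N IH]; intros H; simpl; [lra|].
  specialize (IH ltac:(intros; apply H; lia)). specialize (H N ltac:(lia)). lra.
Qed.

Lemma rsum_nonneg u N : (forall n, 0 <= u n) -> 0 <= rsum u N.
Proof. intros H; induction N; simpl; [lra|]. specialize (H N); lra. Qed.

Lemma rsum_plus u v N : rsum (fun n => u n + v n) N = rsum u N + rsum v N.
Proof. induction N; simpl; lra. Qed.

Lemma rsum_scal k u N : rsum (fun n => k * u n) N = k * rsum u N.
Proof. induction N as [|N IH]; simpl; [ring|]. rewrite IH; ring. Qed.

Lemma rsum_const k N : rsum (fun _ => k) N = INR N * k.
Proof. induction N as [|N IH]; [simpl; ring|]. rewrite S_INR. simpl. rewrite IH. ring. Qed.

Lemma rsum_add u N M : rsum u (N + M) = rsum u N + rsum (fun n => u (N + n)%nat) M.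
Proof.
  induction M as [|M IH]; [rewrite Nat.add_0_r; simpl; ring|].
  rewrite Nat.add_succ_r. simpl. rewrite IH. ring.
Qed.

Lemma rsum_S_l u N : rsum u (S N) = u O + rsum (tail u) N.
Proof. change (S N) with (1 + N)%nat. rewrite rsum_add. simpl. unfold tail. ring. Qed.

Lemma rsum_mono u N M :
  (forall n, 0 <= u n) -> (N <= M)%nat -> rsum u N <= rsum u M.
Proof.
  intros H L. replace M with (N + (M - N))%nat by lia. rewrite rsum_add.
  pose proof (rsum_nonneg (fun n => u (N + n)%nat) (M - N) (fun n => H _)). lra.
Qed.

Lemma term_le_rsum u n N : (forall k, 0 <= u k) -> (n < N)%nat -> u n <= rsum u N.
Proof.
  intros H L. apply Rle_trans with (rsum u (S n)).
  - simpl. pose proof (rsum_nonneg u n H). lra.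
  - apply rsum_mono; auto.
Qed.

Lemma csum_plus u v N : csum (fun n => u n + v n)%C N = (csum u N + csum v N)%C.
Proof. induction N as [|N IH]; simpl; [ring|]. rewrite IH; ring. Qed.

Lemma csum_scal k u N : csum (fun n => k * u n)%C N = (k * csum u N)%C.
Proof. induction N as [|N IH]; simpl; [ring|]. rewrite IH; ring. Qed.

Lemma csum_add u N M :
  csum u (N + M) = (csum u N + csum (fun n => u (N + n)%nat) M)%C.
Proof.
  induction M as [|M IH]; [rewrite Nat.add_0_r; simpl; ring|].
  rewrite Nat.add_succ_r. simpl. rewrite IH. ring.
Qed.

Lemma csum_S_l u N : csum u (S N) = (u O + csum (tail u) N)%C.
Proof. change (S N) with (1 + N)%nat. rewrite csum_add. simpl. unfold tail. ring. Qed.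

Lemma Cmod_csum_le u N : Cmod (csum u N) <= rsum (fun n => Cmod (u n)) N.
Proof.
  induction N as [|N IH]; simpl; [rewrite Cmod_0; lra|].
  eapply Rle_trans; [apply Cmod_triangle|]. lra.
Qed.

Lemma fst_csum u N : fst (csum u N) = rsum (fun n => fst (u n)) N.
Proof. induction N as [|N IH]; simpl; [reflexivity|]. rewrite IH; reflexivity. Qed.

Lemma snd_csum u N : snd (csum u N) = rsum (fun n => snd (u n)) N.
Proof. induction N as [|N IH]; simpl; [reflexivity|]. rewrite IH; reflexivity. Qed.

Lemma rsum_sum_n (u : nat -> R) N : rsum u (S N) = sum_n u N.
Proof.
  induction N as [|N IH]; [simpl; rewrite sum_O; ring|].
  rewrite sum_Sn, <- IH. reflexivity.
Qed.

Lemma csum_sum_n (u : nat -> C) N :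
  csum u (S N) = @sum_n (NormedModule.AbelianMonoid C_AbsRing C_NormedModule) u N.
Proof.
  induction N as [|N IH]; [simpl; rewrite sum_O; ring|].
  rewrite sum_Sn, <- IH. reflexivity.
Qed.

(** * Complex series *)

Definition sums_to (u : nat -> C) (l : C) : Prop :=
  forall eps, 0 < eps ->
    exists N0, forall N, (N0 <= N)%nat -> Cmod (csum u N - l) < eps.

Lemma sums_to_unique u l m : sums_to u l -> sums_to u m -> l = m.
Proof.
  intros Hl Hm. destruct (Req_dec (Cmod (l - m)) 0) as [E|E].
  - apply Cmod_eq_0 in E. replace l with (m + (l - m))%C by ring. rewrite E. ring.
  - exfalso. pose proof (Cmod_ge_0 (l - m)) as P.
    destruct (Hl (Cmod (l - m) / 2) ltac:(lra)) as [N1 H1].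
    destruct (Hm (Cmod (l - m) / 2) ltac:(lra)) as [N2 H2].
    specialize (H1 (N1 + N2)%nat ltac:(lia)). specialize (H2 (N1 + N2)%nat ltac:(lia)).
    assert (Cmod (l - m) <= Cmod (csum u (N1 + N2) - l) + Cmod (csum u (N1 + N2) - m)).
    { rewrite <- (Cmod_opp (csum u (N1 + N2) - l)).
      eapply Rle_trans; [|apply Cmod_triangle]. right. f_equal. ring. }
    lra.
Qed.

Lemma sums_to_ext u v l : (forall n, u n = v n) -> sums_to u l -> sums_to v l.
Proof.
  intros E H eps He. destruct (H eps He) as [N0 HN]. exists N0. intros N L.
  rewrite <- (csum_ext u v N) by auto. auto.
Qed.

Lemma sums_to_plus u v l m :
  sums_to u l -> sums_to v m -> sums_to (fun n => u n + v n)%C (l + m)%C.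
Proof.
  intros Hl Hm eps He.
  destruct (Hl (eps / 2) ltac:(lra)) as [N1 H1].
  destruct (Hm (eps / 2) ltac:(lra)) as [N2 H2].
  exists (N1 + N2)%nat. intros N L.
  specialize (H1 N ltac:(lia)). specialize (H2 N ltac:(lia)).
  rewrite csum_plus.
  replace (csum u N + csum v N - (l + m))%C with ((csum u N - l) + (csum v N - m))%C by ring.
  eapply Rle_lt_trans; [apply Cmod_triangle|]. lra.
Qed.

Lemma sums_to_scal k u l : sums_to u l -> sums_to (fun n => k * u n)%C (k * l)%C.
Proof.
  intros Hl eps He. pose proof (Cmod_ge_0 k) as Pk.
  destruct (Hl (eps / (Cmod k + 1))) as [N1 H1].
  { apply Rdiv_lt_0_compat; lra. }
  exists N1. intros N L. specialize (H1 N L). rewrite csum_scal.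
  replace (k * csum u N - k * l)%C with (k * (csum u N - l))%C by ring.
  rewrite Cmod_mult.
  apply Rle_lt_trans with ((Cmod k) * (eps / (Cmod k + 1))).
  - apply Rmult_le_compat_l; lra.
  - apply Rlt_le_trans with ((Cmod k + 1) * (eps / (Cmod k + 1))).
    + apply Rmult_lt_compat_r; [apply Rdiv_lt_0_compat; lra|lra].
    + right. field. lra.
Qed.

Lemma sums_to_S u l : sums_to (tail u) l -> sums_to u (u O + l)%C.
Proof.
  intros H eps He. destruct (H eps He) as [N0 HN]. exists (S N0). intros [|N] L; [lia|].
  rewrite csum_S_l. replace (u O + csum (tail u) N - (u O + l))%C
    with (csum (tail u) N - l)%C by ring. apply HN; lia.
Qed.

Lemma sums_to_bound u l M :
  (forall N, Cmod (csum u N) <= M) -> sums_to u l -> Cmod l <= M.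
Proof.
  intros B H. apply Rnot_lt_le. intros L.
  destruct (H (Cmod l - M) ltac:(lra)) as [N0 HN]. specialize (HN N0 (le_n _)).
  assert (Cmod l <= Cmod (csum u N0) + Cmod (csum u N0 - l)).
  { rewrite <- (Cmod_opp (csum u N0 - l)).
    eapply Rle_trans; [|apply Cmod_triangle]. right; f_equal; ring. }
  specialize (B N0). lra.
Qed.

Lemma sums_to_is_series u l : sums_to u l <-> @is_series C_AbsRing C_NormedModule u l.
Proof.
  split.
  - intros H. unfold is_series. apply filterlim_locally_ball_norm. intros eps.
    destruct (H eps (cond_pos eps)) as [N0 HN]. exists N0. intros N L.
    unfold ball_norm. rewrite <- csum_sum_n. apply HN. lia.
  - intros H eps He. unfold is_series in H.
    apply (proj1 (filterlim_locally_ball_norm _ _)) with (eps := mkposreal eps He) in H.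
    destruct H as [N0 HN]. exists (S N0). intros [|N] L; [lia|].
    specialize (HN N ltac:(lia)). unfold ball_norm in HN.
    rewrite <- csum_sum_n in HN. exact HN.
Qed.

(** * Summable coefficient sequences and their values *)

Definition l1_bound (a : nat -> C) (M : R) : Prop :=
  forall N, rsum (fun n => Cmod (a n)) N <= M.

Definition l1 (a : nat -> C) : Prop := exists M, l1_bound a M.

Lemma ex_series_bounded (u : nat -> R) M :
  (forall n, 0 <= u n) -> (forall N, rsum u N <= M) -> ex_series u.
Proof.
  intros P B.
  destruct (ex_finite_lim_seq_incr (sum_n u) M) as [l Hl].
  - intros n. rewrite sum_Sn. specialize (P (S n)). unfold plus; simpl. lra.
  - intros n. rewrite <- rsum_sum_n. apply B.
  - exists l. exact Hl.
Qed.

(** Real and imaginary parts are summed separately by the real theory of series. *)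
Lemma Series_sums (u : nat -> C) :
  l1 u -> sums_to u (Series (fun n => fst (u n)), Series (fun n => snd (u n))).
Proof.
  intros [M HM].
  assert (EX : forall p : C -> R, (forall z, Rabs (p z) <= Cmod z) ->
    forall eps, 0 < eps -> exists N0, forall N, (N0 <= N)%nat ->
      Rabs (rsum (fun n => p (u n)) N - Series (fun n => p (u n))) < eps).
  { intros p Hp eps He.
    assert (E : ex_series (fun n => p (u n))).
    { apply ex_series_Rabs. apply ex_series_bounded with M; [intros; apply Rabs_pos|].
      intros N. eapply Rle_trans; [|apply (HM N)]. apply rsum_le. intros; apply Hp. }
    apply Series_correct in E. apply is_series_Reals in E.
    destruct (E eps He) as [N0 HN]. exists (S N0). intros [|N] L; [lia|].
    specialize (HN N ltac:(lia)). unfold Rdist in HN. rewrite <- sum_n_Reals in HN.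
    rewrite <- rsum_sum_n in HN. exact HN. }
  intros eps He.
  destruct (EX fst (fun z => re_le_Cmod z) (eps / 2) ltac:(lra)) as [N1 H1].
  destruct (EX snd) with (eps := eps / 2) as [N2 H2].
  { intros z. eapply Rle_trans; [|apply Rmax_Cmod]. apply Rmax_r. } { lra. }
  exists (N1 + N2)%nat. intros N L.
  specialize (H1 N ltac:(lia)). specialize (H2 N ltac:(lia)).
  rewrite <- fst_csum in H1. rewrite <- snd_csum in H2.
  set (A := Series (fun n => fst (u n))) in *. set (B := Series (fun n => snd (u n))) in *.
  destruct (csum u N) as [x y].
  simpl in H1, H2.
  replace ((x, y) - (A, B))%C with (RtoC (x - A) + Ci * RtoC (y - B))%C.
  - eapply Rle_lt_trans; [apply Cmod_triangle|]. rewrite Cmod_mult, Cmod_Ci, !Cmod_R. lra.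
  - unfold RtoC, Ci, Cminus, Cplus, Cmult, Copp; simpl. f_equal; ring.
Qed.

(** Summing real and imaginary parts makes the value a total function of the
    coefficients; it is meaningful when the terms are summable, see [eval_terms]. *)
Definition eval (a : nat -> C) (z : C) : C :=
  (Series (fun n => fst (a n * z ^ n)%C), Series (fun n => snd (a n * z ^ n)%C)).

(** Coefficients of [z |-> a(s z)]. Rescaling turns statements on a disk of radius
    less than one into statements about absolutely summable sequences. *)
Definition dilate (s : R) (a : nat -> C) : nat -> C := fun n => (a n * RtoC s ^ n)%C.

Lemma l1_bound_term a M n : l1_bound a M -> Cmod (a n) <= M.
Proof.
  intros H. eapply Rle_trans; [|apply (H (S n))].
  apply (term_le_rsum (fun n => Cmod (a n))); [intros; apply Cmod_ge_0|lia].
Qed.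

Lemma l1_bound_nonneg a M : l1_bound a M -> 0 <= M.
Proof. intros H. apply (H O). Qed.

Lemma l1_bound_le a b M :
  (forall n, Cmod (a n) <= Cmod (b n)) -> l1_bound b M -> l1_bound a M.
Proof. intros L H N. eapply Rle_trans; [|apply H]. apply rsum_le; auto. Qed.

Lemma l1_bound_tail a M : l1_bound a M -> l1_bound (tail a) M.
Proof.
  intros H N. specialize (H (S N)). rewrite rsum_S_l in H.
  pose proof (Cmod_ge_0 (a O)). unfold tail in *. lra.
Qed.

Lemma l1_tail a : l1 a -> l1 (tail a).
Proof. intros [M H]. exists M. apply l1_bound_tail, H. Qed.

Lemma l1_bound_plus a b M M' :
  l1_bound a M -> l1_bound b M' -> l1_bound (fun n => a n + b n)%C (M + M').
Proof.
  intros Ha Hb N. specialize (Ha N); specialize (Hb N).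
  eapply Rle_trans; [apply rsum_le; intros; apply Cmod_triangle|].
  rewrite rsum_plus. lra.
Qed.

Lemma l1_bound_scal k a M : l1_bound a M -> l1_bound (fun n => k * a n)%C (Cmod k * M).
Proof.
  intros Ha N. specialize (Ha N).
  rewrite (rsum_ext _ (fun n => Cmod k * Cmod (a n))) by (intros; apply Cmod_mult).
  rewrite rsum_scal. apply Rmult_le_compat_l; [apply Cmod_ge_0|auto].
Qed.

Lemma l1_plus a b : l1 a -> l1 b -> l1 (fun n => a n + b n)%C.
Proof. intros [M H] [M' H']. eexists; apply l1_bound_plus; eassumption. Qed.

Lemma l1_scal k a : l1 a -> l1 (fun n => k * a n)%C.
Proof. intros [M H]. eexists; apply l1_bound_scal; eassumption. Qed.

Lemma pow_le_1 x n : 0 <= x <= 1 -> 0 <= x ^ n <= 1.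
Proof.
  intros H. split; [apply pow_le; lra|].
  induction n as [|n IH]; simpl; [lra|].
  assert (0 <= x ^ n) by (apply pow_le; lra). nra.
Qed.

Lemma Cmod_term_le (a : nat -> C) z n : Cmod z <= 1 -> Cmod (a n * z ^ n) <= Cmod (a n).
Proof.
  intros H. rewrite Cmod_mult, Cmod_pow.
  pose proof (pow_le_1 (Cmod z) n (conj (Cmod_ge_0 z) H)).
  pose proof (Cmod_ge_0 (a n)). nra.
Qed.

Lemma l1_bound_terms a M z :
  l1_bound a M -> Cmod z <= 1 -> l1_bound (fun n => a n * z ^ n)%C M.
Proof.
  intros H Hz. apply l1_bound_le with a; [|auto]. intros n; apply Cmod_term_le, Hz.
Qed.

Lemma eval_terms a z :
  l1 (fun n => a n * z ^ n)%C -> sums_to (fun n => a n * z ^ n)%C (eval a z).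
Proof. apply Series_sums. Qed.

Lemma eval_sums a z : l1 a -> Cmod z <= 1 -> sums_to (fun n => a n * z ^ n)%C (eval a z).
Proof. intros [M H] Hz. apply eval_terms. exists M. apply l1_bound_terms; auto. Qed.

Lemma eval_ext a b z : (forall n, a n = b n) -> eval a z = eval b z.
Proof. intros E. unfold eval. f_equal; apply Series_ext; intros n; rewrite E; reflexivity. Qed.

Lemma eval_dilate s a z : eval (dilate s a) z = eval a (RtoC s * z)%C.
Proof.
  unfold eval, dilate.
  f_equal; apply Series_ext; intros n; f_equal; rewrite Cpow_mult_l; ring.
Qed.

Lemma eval_bound a M z : l1_bound a M -> Cmod z <= 1 -> Cmod (eval a z) <= M.
Proof.
  intros H Hz. apply sums_to_bound with (fun n => a n * z ^ n)%C.
  - intros N. eapply Rle_trans; [apply Cmod_csum_le|]. apply l1_bound_terms; auto.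
  - apply eval_sums; [exists M|]; auto.
Qed.

Lemma eval_plus a b z :
  l1 a -> l1 b -> Cmod z <= 1 -> eval (fun n => a n + b n)%C z = (eval a z + eval b z)%C.
Proof.
  intros Ha Hb Hz. eapply sums_to_unique.
  - apply eval_sums; [apply l1_plus|]; auto.
  - eapply sums_to_ext; [|apply sums_to_plus; apply eval_sums; eauto].
    intros n; simpl; ring.
Qed.

Lemma eval_scal k a z :
  l1 a -> Cmod z <= 1 -> eval (fun n => k * a n)%C z = (k * eval a z)%C.
Proof.
  intros Ha Hz. eapply sums_to_unique.
  - apply eval_sums; [apply l1_scal|]; auto.
  - eapply sums_to_ext; [|apply sums_to_scal; apply eval_sums; eauto].
    intros n; simpl; ring.
Qed.

(** a(z) = a_0 + z a'(z), where a' has the shifted coefficients. All identities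
    between values of series below are obtained from this one. *)
Lemma eval_S a z :
  l1 a -> Cmod z <= 1 -> eval a z = (a O + z * eval (tail a) z)%C.
Proof.
  intros Ha Hz. eapply sums_to_unique; [apply eval_sums; auto|].
  replace (a O) with (a O * z ^ 0)%C by (simpl; ring).
  apply (sums_to_S (fun n => a n * z ^ n)%C).
  eapply sums_to_ext; [|apply sums_to_scal, eval_sums; eauto using l1_tail].
  intros n; unfold tail; simpl; ring.
Qed.

(** * Convolution *)

(** The Cauchy product, by recursion on the head and tail of the first factor:
    a b = a_0 b + z a' b. With this form the ring laws are short inductions. *)
Fixpoint conv (a b : nat -> C) (n : nat) : C :=
  match n with
  | O => (a O * b O)%C
  | S m => (a O * b (S m) + conv (tail a) b m)%C
  end.

Lemma conv_ext a a' b b' n :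
  (forall k, (k <= n)%nat -> a k = a' k) -> (forall k, (k <= n)%nat -> b k = b' k) ->
  conv a b n = conv a' b' n.
Proof.
  revert a a' b b'; induction n as [|n IH]; intros a a' b b' Ha Hb; simpl.
  - rewrite Ha, Hb by lia; reflexivity.
  - rewrite Ha, Hb by lia. f_equal. apply IH.
    + intros k Hk; apply Ha; lia.
    + intros k Hk; apply Hb; lia.
Qed.

Lemma conv_plus_l a a' b n :
  conv (fun k => a k + a' k)%C b n = (conv a b n + conv a' b n)%C.
Proof.
  revert a a' b; induction n as [|n IH]; intros a a' b; simpl; [ring|].
  unfold tail at 1. rewrite (IH (fun k => a (S k)) (fun k => a' (S k))).
  unfold tail. ring.
Qed.

Lemma conv_scal_l k a b n : conv (fun m => k * a m)%C b n = (k * conv a b n)%C.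
Proof.
  revert a b; induction n as [|n IH]; intros a b; simpl; [ring|].
  unfold tail at 1. rewrite (IH (fun k => a (S k))).
  unfold tail. ring.
Qed.

Lemma conv_S_r a b n : conv a b (S n) = (conv a (tail b) n + a (S n) * b O)%C.
Proof.
  revert a; induction n as [|n IH]; intros a.
  - simpl. unfold tail. ring.
  - change (conv a b (S (S n))) with (a O * b (S (S n)) + conv (tail a) b (S n))%C.
    rewrite IH. simpl. unfold tail. ring.
Qed.

Lemma conv_comm a b n : conv a b n = conv b a n.
Proof.
  revert a b; induction n as [|n IH]; intros a b; [simpl; ring|].
  rewrite conv_S_r. simpl. rewrite IH. unfold tail at 1. unfold tail. ring.
Qed.

Lemma conv_assoc a b c n : conv (conv a b) c n = conv a (conv b c) n.
Proof.
  revert a; induction n as [|n IH]; intros a; [simpl; ring|].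
  change (conv (conv a b) c (S n))
    with (a O * b O * c (S n)
          + conv (fun m => a O * tail b m + conv (tail a) b m)%C c n)%C.
  rewrite conv_plus_l, conv_scal_l, IH. simpl. unfold tail. ring.
Qed.

Definition series_one : nat -> C := fun n => match n with O => RtoC 1 | S _ => RtoC 0 end.

Lemma conv_0_l b n : conv (fun _ => RtoC 0) b n = RtoC 0.
Proof.
  induction n as [|n IH]; simpl; [ring|].
  unfold tail. rewrite IH. ring.
Qed.

Lemma conv_1_l a n : conv series_one a n = a n.
Proof.
  destruct n as [|n]; simpl; [ring|].
  change (tail series_one) with (fun _ : nat => RtoC 0). rewrite conv_0_l. ring.
Qed.

Lemma conv_1_r a n : conv a series_one n = a n.
Proof. rewrite conv_comm. apply conv_1_l. Qed.

Lemma conv_dilate s a b n : conv (dilate s a) (dilate s b) n = dilate s (conv a b) n.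
Proof.
  revert a; induction n as [|n IH]; intros a; [unfold dilate; simpl; ring|].
  simpl.
  rewrite (conv_ext (tail (dilate s a)) (fun k => RtoC s * dilate s (tail a) k)%C
                    (dilate s b) (dilate s b)); [|intros; unfold tail, dilate; simpl; ring|auto].
  rewrite conv_scal_l, IH. unfold dilate. simpl. ring.
Qed.

Lemma rsum_conv_le a b N :
  rsum (fun n => Cmod (conv a b n)) N
  <= rsum (fun n => Cmod (a n)) N * rsum (fun n => Cmod (b n)) N.
Proof.
  revert a; induction N as [|N IH]; intros a; [simpl; lra|].
  rewrite rsum_S_l, (rsum_S_l (fun n => Cmod (a n))).
  rewrite (rsum_S_l (fun n => Cmod (b n))) at 1.
  specialize (IH (tail a)).
  set (A := rsum (fun n => Cmod (tail a n)) N) in *.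
  change (rsum (tail (fun n => Cmod (a n))) N) with A.
  change (rsum (fun n => Cmod (b n)) N) with (rsum (fun n => Cmod (b n)) N) in IH.
  assert (HA : 0 <= A) by (apply rsum_nonneg; intros; apply Cmod_ge_0).
  assert (H : rsum (tail (fun n => Cmod (conv a b n))) N
     <= Cmod (a O) * rsum (tail (fun n => Cmod (b n))) N
        + A * rsum (fun n => Cmod (b n)) N).
  { eapply Rle_trans; [|apply Rplus_le_compat_l, IH].
    rewrite <- rsum_scal, <- rsum_plus. apply rsum_le. intros n _. unfold tail at 1. simpl.
    eapply Rle_trans; [apply Cmod_triangle|]. rewrite Cmod_mult. unfold tail at 2. lra. }
  assert (HB : rsum (fun n => Cmod (b n)) N
     <= Cmod (b O) + rsum (tail (fun n => Cmod (b n))) N).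
  { rewrite <- (rsum_S_l (fun n => Cmod (b n))). apply rsum_mono; [intros; apply Cmod_ge_0|lia]. }
  simpl (conv a b 0). rewrite Cmod_mult. nra.
Qed.

Lemma l1_bound_conv a b M M' :
  l1_bound a M -> l1_bound b M' -> l1_bound (conv a b) (M * M').
Proof.
  intros Ha Hb N. eapply Rle_trans; [apply rsum_conv_le|].
  apply Rmult_le_compat; auto; apply rsum_nonneg; intros; apply Cmod_ge_0.
Qed.

Lemma l1_conv a b : l1 a -> l1 b -> l1 (conv a b).
Proof. intros [M H] [M' H']. eexists; apply l1_bound_conv; eassumption. Qed.

(** Beyond an index whose partial sum is within [eps] of the supremum, the remaining
    terms sum to at most [eps]. *)
Lemma l1_bound_small_tail a eps :
  l1 a -> 0 < eps -> exists m, forall k, (m <= k)%nat -> l1_bound (fun n => a (k + n)%nat) eps.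
Proof.
  intros [M HM] He.
  destruct (completeness (fun x => exists N, x = rsum (fun n => Cmod (a n)) N)) as [S [U L]].
  - exists M. intros x [N ->]. apply HM.
  - exists 0, O. reflexivity.
  - destruct (classic (exists m, S - eps < rsum (fun n => Cmod (a n)) m)) as [[m Hm]|Hn].
    + exists m. intros k Hk N. pose proof (U _ (ex_intro _ (k + N)%nat eq_refl)) as HU.
      rewrite rsum_add in HU.
      pose proof (rsum_mono (fun n => Cmod (a n)) m k (fun n => Cmod_ge_0 _) Hk). lra.
    + exfalso. assert (S <= S - eps); [|lra]. apply L. intros x [N ->].
      apply Rnot_lt_le. intros H. apply Hn. exists N. exact H.
Qed.

Lemma eval_conv_S a b z :
  l1 a -> l1 b -> Cmod z <= 1 ->
  eval (conv a b) z = (a O * eval b z + z * eval (conv (tail a) b) z)%C.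
Proof.
  intros Ha Hb Hz.
  rewrite (eval_S (conv a b)), (eval_S b z) by (auto using l1_conv).
  rewrite (eval_ext (tail (conv a b)) (fun n => a O * tail b n + conv (tail a) b n)%C)
    by reflexivity.
  rewrite eval_plus, eval_scal; auto using l1_tail, l1_conv, l1_scal. simpl. ring.
Qed.

Lemma Cmod_sub_eq x y : (forall eps, 0 < eps -> Cmod (x - y) <= eps) -> x = y.
Proof.
  intros H. destruct (Req_dec (Cmod (x - y)) 0) as [E|E].
  - apply Cmod_eq_0 in E. replace x with (y + (x - y))%C by ring. rewrite E. ring.
  - pose proof (Cmod_ge_0 (x - y)). specialize (H (Cmod (x - y) / 2) ltac:(lra)). lra.
Qed.

(** By [eval_conv_S], replacing a by its tail in (ab)(z) - a(z) b(z) only costs a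
    factor z. After m steps the tail of a is as small as desired. *)
Lemma eval_conv a b z :
  l1 a -> l1 b -> Cmod z <= 1 -> eval (conv a b) z = (eval a z * eval b z)%C.
Proof.
  intros Ha Hb Hz.
  assert (E : forall m a, l1 a ->
    (eval (conv a b) z - eval a z * eval b z
     = z ^ m * (eval (conv (fun n => a (m + n)%nat) b) z
                - eval (fun n => a (m + n)%nat) z * eval b z))%C).
  { clear a Ha. induction m as [|m IH]; intros a Ha.
    - simpl. change (fun n => a n) with a. ring.
    - rewrite eval_conv_S, (eval_S a) by auto. simpl.
      transitivity (z * (eval (conv (tail a) b) z - eval (tail a) z * eval b z))%C; [ring|].
      rewrite (IH (tail a)) by (apply l1_tail, Ha). unfold tail. simpl. ring. }
  destruct Hb as [B HB]. pose proof (l1_bound_nonneg _ _ HB) as PB.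
  apply Cmod_sub_eq. intros eps He.
  destruct (l1_bound_small_tail a (eps / (2 * B + 1)) Ha) as [m Hm].
  { apply Rdiv_lt_0_compat; lra. }
  specialize (Hm m (le_n _)). rewrite (E m a Ha), Cmod_mult, Cmod_pow.
  pose proof (pow_le_1 (Cmod z) m (conj (Cmod_ge_0 z) Hz)) as Pz.
  set (e := eps / (2 * B + 1)) in *.
  assert (He' : e * (2 * B + 1) = eps) by (unfold e; field; lra).
  pose proof (l1_bound_nonneg _ _ Hm) as Pe.
  assert (H1 : Cmod (eval (conv (fun n => a (m + n)%nat) b) z
                - eval (fun n => a (m + n)%nat) z * eval b z) <= e * B + e * B).
  { eapply Rle_trans; [apply Cmod_triangle|]. rewrite Cmod_opp, Cmod_mult.
    apply Rplus_le_compat.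
    - apply eval_bound; auto using l1_bound_conv.
    - apply Rmult_le_compat; try apply Cmod_ge_0; apply eval_bound; auto. }
  match goal with |- _ * ?X <= _ => set (Y := X) in * end.
  assert (0 <= Y) by apply Cmod_ge_0. nra.
Qed.


(** * Parseval over roots of unity and multipliers *)

Definition unity_root (M : nat) : C := (cos (2 * PI / INR M), sin (2 * PI / INR M)).

Lemma root_pow M k : (unity_root M ^ k)%C = (cos (INR k * (2 * PI / INR M)), sin (INR k * (2 * PI / INR M))).
Proof.
  induction k as [|k IH].
  - simpl. rewrite Rmult_0_l, cos_0, sin_0. reflexivity.
  - rewrite Cpow_S, IH, S_INR, Rmult_plus_distr_r, Rmult_1_l, cos_plus, sin_plus.
    unfold unity_root, Cmult; simpl. f_equal; ring.
Qed.

Lemma Cmod_root_pow M k : Cmod (unity_root M ^ k)%C = 1.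
Proof.
  rewrite root_pow. unfold Cmod; simpl.
  match goal with |- sqrt ?x = _ => replace x with 1 end; [apply sqrt_1|].
  pose proof (sin2_cos2 (INR k * (2 * PI / INR M))) as H. unfold Rsqr in H. lra.
Qed.

Lemma root_pow_order M : (0 < M)%nat -> (unity_root M ^ M)%C = RtoC 1.
Proof.
  intros H. rewrite root_pow.
  replace (INR M * (2 * PI / INR M)) with (2 * PI).
  - rewrite cos_2PI, sin_2PI. reflexivity.
  - field. apply not_0_INR. lia.
Qed.

Lemma root_pow_neq_1 M k : (0 < k < M)%nat -> (unity_root M ^ k)%C <> RtoC 1.
Proof.
  intros [H1 H2] E. rewrite root_pow in E. injection E as Ec Es.
  apply lt_INR in H2. apply lt_INR in H1. simpl in H1.
  pose proof PI_RGT_0 as HP.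
  replace (INR k * (2 * PI / INR M)) with (2 * (INR k / INR M * PI)) in Ec by (field; lra).
  rewrite cos_2a_sin in Ec.
  assert (0 < sin (INR k / INR M * PI)); [|nra].
  assert (0 < INR k / INR M) by (apply Rdiv_lt_0_compat; lra).
  assert (INR k / INR M < 1) by (apply Rlt_div_l; lra).
  apply sin_gt_0; nra.
Qed.

Lemma Cmod_sqr_plus u v :
  Cmod (u + v) ^ 2 = Cmod u ^ 2 + Cmod v ^ 2 + 2 * fst (u * Cconj v)%C.
Proof.
  rewrite !Cmod2_alt. destruct u as [a b], v as [c d]. simpl. ring.
Qed.

Lemma geometric_csum (x : C) M : ((x - 1) * csum (fun j => x ^ j) M)%C = (x ^ M - 1)%C.
Proof. induction M as [|M IH]; simpl; [ring|]. rewrite Cmult_plus_distr_l, IH. ring. Qed.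

(** The sum is geometric, with ratio x = w^n / w^k different from 1 and x^M = 1. *)
Lemma root_orthogonal M n k :
  (n < k < M)%nat ->
  csum (fun j => (unity_root M ^ j) ^ n * Cconj ((unity_root M ^ j) ^ k))%C M = RtoC 0.
Proof.
  intros [H1 H2]. set (w := unity_root M).
  assert (Hc : (w ^ k * Cconj (w ^ k) = 1)%C).
  { rewrite <- Cmod2_conj. unfold w. rewrite Cmod_root_pow. f_equal. ring. }
  set (x := (w ^ n * Cconj (w ^ k))%C).
  rewrite (csum_ext _ (fun j => x ^ j)%C).
  2:{ intros j _. unfold x. rewrite Cpow_mult_l, !Cpow_conj, <- !Cpow_mult_r.
      rewrite (Nat.mul_comm n), (Nat.mul_comm k). reflexivity. }
  assert (Hx : (x - 1)%C <> RtoC 0).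
  { intros E. apply (root_pow_neq_1 M (k - n)); [lia|]. fold w.
    assert (E1 : (x * w ^ k = w ^ k)%C).
    { replace x with ((x - 1) + 1)%C by ring. rewrite E. ring. }
    assert (E2 : (w ^ n = w ^ k)%C).
    { rewrite <- E1. unfold x. rewrite <- Cmult_assoc, (Cmult_comm (Cconj _)), Hc. ring. }
    assert (Hn : (w ^ n)%C <> RtoC 0).
    { apply Cmod_gt_0. unfold w. rewrite Cmod_root_pow. lra. }
    replace k with (n + (k - n))%nat in E2 by lia. rewrite Cpow_add_r in E2.
    transitivity (/ w ^ n * (w ^ n * w ^ (k - n)))%C; [field; auto|].
    rewrite <- E2. field; auto. }
  assert (E : ((x - 1) * csum (fun j => x ^ j) M = 0)%C).
  { rewrite geometric_csum. unfold x.
    rewrite Cpow_mult_l, <- Cpow_conj, <- !Cpow_mult_r, (Nat.mul_comm n), (Nat.mul_comm k).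
    rewrite !Cpow_mult_r. unfold w. rewrite root_pow_order, !Cpow_1_l by lia.
    unfold Cconj, RtoC, Cminus, Cplus, Cmult, Copp; simpl. f_equal; ring. }
  transitivity (/ (x - 1) * ((x - 1) * csum (fun j => x ^ j) M))%C; [field; auto|].
  rewrite E. ring.
Qed.

Definition taylor_poly (p : nat -> C) (N : nat) (z : C) : C := csum (fun n => p n * z ^ n)%C N.

Lemma taylor_poly_orthogonal p M n k :
  (n <= k < M)%nat ->
  csum (fun j => taylor_poly p n (unity_root M ^ j) * Cconj ((unity_root M ^ j) ^ k))%C M = RtoC 0.
Proof.
  induction n as [|n IH]; intros H.
  - rewrite (csum_ext _ (fun _ => RtoC 0 * RtoC 0)%C), csum_scal; [ring|].
    intros j _. unfold taylor_poly; simpl. ring.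
  - rewrite (csum_ext _ (fun j => taylor_poly p n (unity_root M ^ j) * Cconj ((unity_root M ^ j) ^ k)
       + p n * ((unity_root M ^ j) ^ n * Cconj ((unity_root M ^ j) ^ k)))%C).
    + rewrite csum_plus, csum_scal, IH, root_orthogonal by lia. ring.
    + intros j _. unfold taylor_poly. simpl. ring.
Qed.

(** Induction on the degree: the new monomial is orthogonal to the previous ones by
    [taylor_poly_orthogonal]. *)
Lemma parseval p M N :
  (N <= M)%nat ->
  rsum (fun j => Cmod (taylor_poly p N (unity_root M ^ j)%C) ^ 2) M
  = INR M * rsum (fun n => Cmod (p n) ^ 2) N.
Proof.
  induction N as [|N IH]; intros H.
  - rewrite (rsum_ext _ (fun _ => 0)).
    + rewrite rsum_const. simpl. ring.
    + intros j _. unfold taylor_poly; simpl. rewrite Cmod_0. ring.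
  - rewrite (rsum_ext _ (fun j => (Cmod (taylor_poly p N (unity_root M ^ j)%C) ^ 2 + Cmod (p N) ^ 2)
       + 2 * fst (Cconj (p N) * (taylor_poly p N (unity_root M ^ j) * Cconj ((unity_root M ^ j) ^ N)))%C)).
    + rewrite !rsum_plus, rsum_scal, <- fst_csum, csum_scal, taylor_poly_orthogonal, IH by lia.
      rewrite rsum_const, Cmult_0_r. simpl. ring.
    + intros j _. unfold taylor_poly at 1. simpl csum. fold (taylor_poly p N (unity_root M ^ j)%C).
      rewrite Cmod_sqr_plus, Cmult_conj, Cmod_mult, Cmod_pow, Cmod_root_pow, pow1.
      do 2 f_equal; [ring|]. f_equal. ring.
Qed.

Lemma eval_split a z m :
  l1 a -> Cmod z <= 1 ->
  eval a z = (taylor_poly a m z + z ^ m * eval (fun n => a (m + n)%nat) z)%C.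
Proof.
  intros Ha Hz. unfold taylor_poly. induction m as [|m IH].
  - simpl. change (fun n => a n) with a. ring.
  - rewrite IH, (eval_S (fun n => a (m + n)%nat)); auto.
    + rewrite Nat.add_0_r. simpl.
      rewrite (eval_ext (tail (fun n => a (m + n)%nat)) (fun n => a (S (m + n)))).
      * ring.
      * intros n. unfold tail. f_equal. lia.
    + destruct Ha as [M HM]. exists M. intros N. specialize (HM (m + N)%nat).
      rewrite rsum_add in HM.
      pose proof (rsum_nonneg (fun n => Cmod (a n)) m (fun n => Cmod_ge_0 _)). lra.
Qed.

(** Only the first [N] coefficients of [y] matter, so [y] may be taken polynomial.
    Compare Parseval for [y] with Parseval for a long truncation of [conv x y],
    which on the unit circle is at most q |y(z)| up to an arbitrarily small error.
    The truncation on both sides allows [y] to be any sequence, in particular one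
    whose summability is still to be proved. *)
Lemma multiplier_contraction x q y N :
  l1 x -> 0 <= q -> (forall z, Cmod z = 1 -> Cmod (eval x z) <= q) ->
  rsum (fun n => Cmod (conv x y n) ^ 2) N <= q ^ 2 * rsum (fun n => Cmod (y n) ^ 2) N.
Proof.
  intros Hx Hq Hb.
  set (y' := fun n => if Nat.ltb n N then y n else RtoC 0).
  assert (Ey : forall n, (n < N)%nat -> y' n = y n).
  { intros n Hn. unfold y'. apply Nat.ltb_lt in Hn. rewrite Hn. reflexivity. }
  assert (Ey0 : forall n, (N <= n)%nat -> y' n = RtoC 0).
  { intros n Hn. unfold y'. apply Nat.ltb_ge in Hn. rewrite Hn. reflexivity. }
  set (B := rsum (fun n => Cmod (y' n)) N).
  assert (HB : l1_bound y' B).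
  { intros K. destruct (Nat.le_gt_cases K N) as [L|L].
    - apply rsum_mono; auto. intros; apply Cmod_ge_0.
    - replace K with (N + (K - N))%nat by lia. rewrite rsum_add.
      rewrite (rsum_ext (fun n => Cmod (y' (N + n)%nat)) (fun _ => 0)), rsum_const.
      + unfold B. lra.
      + intros n _. rewrite Ey0 by lia. apply Cmod_0. }
  pose proof (l1_bound_nonneg _ _ HB) as PB.
  assert (Hy' : l1 y') by (exists B; auto).
  set (h := conv x y'). assert (Hh : l1 h) by (apply l1_conv; auto).
  rewrite (rsum_ext _ (fun n => Cmod (h n) ^ 2)).
  2:{ intros n Hn. unfold h. do 2 f_equal. apply conv_ext; auto. intros; rewrite Ey by lia; auto. }
  rewrite (rsum_ext (fun n => Cmod (y n) ^ 2) (fun n => Cmod (y' n) ^ 2)).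
  2:{ intros n Hn. rewrite Ey by lia. reflexivity. }
  set (S := rsum (fun n => Cmod (y' n) ^ 2) N).
  apply Rnot_lt_le. intros L.
  set (H2 := rsum (fun n => Cmod (h n) ^ 2) N) in *.
  (* the truncation error: small enough for the total error e (2 q B + 1) to stay
     below the assumed gap *)
  set (e := Rmin 1 ((H2 - q ^ 2 * S) / (2 * (2 * q * B + 1)))).
  assert (PC : 0 < 2 * q * B + 1) by nra.
  assert (He : 0 < e).
  { apply Rmin_glb_lt; [lra|]. apply Rdiv_lt_0_compat; lra. }
  assert (He1 : e <= 1) by apply Rmin_l.
  assert (He2 : e * (2 * q * B + 1) < H2 - q ^ 2 * S).
  { apply Rle_lt_trans with ((H2 - q ^ 2 * S) / (2 * (2 * q * B + 1)) * (2 * q * B + 1)).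
    - apply Rmult_le_compat_r; [lra|apply Rmin_r].
    - replace (_ / _ * _) with ((H2 - q ^ 2 * S) / 2) by (field; lra). lra. }
  destruct (l1_bound_small_tail h e Hh He) as [m Hm].
  set (M := Datatypes.S (m + N)).
  specialize (Hm M ltac:(unfold M; lia)).
  assert (PM : 0 < INR M) by (apply lt_0_INR; unfold M; lia).
  (* on the circle |h| <= q |y|; truncating h at M costs at most e *)
  assert (K : forall j, Cmod (taylor_poly h M (unity_root M ^ j)%C) ^ 2
     <= q ^ 2 * Cmod (taylor_poly y' N (unity_root M ^ j)%C) ^ 2 + e * (2 * q * B + 1)).
  { intros j. set (z := (unity_root M ^ j)%C). assert (Hz : Cmod z = 1) by apply Cmod_root_pow.
    assert (EY : eval y' z = taylor_poly y' N z).
    { rewrite (eval_split y' z N) by (auto; lra).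
      rewrite (eval_ext _ (fun n => RtoC 0 * y' n)%C).
      - rewrite eval_scal by (auto; lra). ring.
      - intros n. rewrite Ey0 by lia. ring. }
    assert (B1 : Cmod (taylor_poly y' N z) <= B) by (rewrite <- EY; apply eval_bound; [auto|lra]).
    assert (B2 : Cmod (eval h z) <= q * Cmod (taylor_poly y' N z)).
    { unfold h. rewrite eval_conv, Cmod_mult, EY by (auto; lra).
      apply Rmult_le_compat_r; [apply Cmod_ge_0|auto]. }
    assert (B3 : Cmod (taylor_poly h M z) <= q * Cmod (taylor_poly y' N z) + e).
    { replace (taylor_poly h M z) with (eval h z + - (z ^ M * eval (fun n => h (M + n)%nat) z))%C.
      - eapply Rle_trans; [apply Cmod_triangle|].
        rewrite Cmod_opp, Cmod_mult, Cmod_pow, Hz, pow1, Rmult_1_l.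
        apply Rplus_le_compat; [auto|]. apply eval_bound; [auto|lra].
      - rewrite (eval_split h z M) by (auto; lra). ring. }
    pose proof (Cmod_ge_0 (taylor_poly h M z)). pose proof (Cmod_ge_0 (taylor_poly y' N z)).
    set (u := Cmod (taylor_poly h M z)) in *. set (v := Cmod (taylor_poly y' N z)) in *.
    assert (u ^ 2 <= (q * v + e) ^ 2) by (apply pow_incr; lra).
    assert (q * v <= q * B) by nra. nra. }
  assert (T : INR M * rsum (fun n => Cmod (h n) ^ 2) M
              <= INR M * (q ^ 2 * S + e * (2 * q * B + 1))).
  { rewrite <- (parseval h M M) by lia.
    eapply Rle_trans; [apply rsum_le; intros j _; apply K|].
    rewrite rsum_plus, rsum_scal, rsum_const, (parseval y' M N) by (unfold M; lia).
    unfold S. right; ring. }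
  apply Rmult_le_reg_l in T; [|auto].
  assert (H2 <= rsum (fun n => Cmod (h n) ^ 2) M).
  { apply rsum_mono; [intros; apply pow2_ge_0|unfold M; lia]. }
  lra.
Qed.

Lemma coef_0_bound x q :
  l1 x -> 0 <= q -> (forall z, Cmod z = 1 -> Cmod (eval x z) <= q) -> Cmod (x O) <= q.
Proof.
  intros Hx Hq Hb. pose proof (multiplier_contraction x q series_one 1 Hx Hq Hb) as H.
  simpl in H. rewrite Cmult_1_r, Cmod_1 in H. pose proof (Cmod_ge_0 (x O)). nra.
Qed.

(** The case q = 0 of the multiplier bound: the uniqueness of coefficients. *)
Lemma eval_zero_coefs x : l1 x -> (forall z, Cmod z = 1 -> eval x z = RtoC 0) ->
  forall n, x n = RtoC 0.
Proof.
  intros Hx Hb n. apply Cmod_eq_0.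
  pose proof (multiplier_contraction x 0 series_one (S n) Hx (Rle_refl 0)) as H.
  assert (H' : rsum (fun n => Cmod (x n) ^ 2) (S n) <= 0).
  { rewrite (rsum_ext _ (fun n => Cmod (conv x series_one n) ^ 2)).
    - eapply Rle_trans; [apply H|]; [|right; ring].
      intros z Hz. rewrite Hb by auto. rewrite Cmod_0. lra.
    - intros; rewrite conv_1_r; reflexivity. }
  pose proof (term_le_rsum (fun n => Cmod (x n) ^ 2) n (S n) (fun n => pow2_ge_0 _) (Nat.lt_succ_diag_r n)) as T.
  simpl in T, H'. nra.
Qed.

Lemma conv_single x y k :
  (forall n, (n < k)%nat -> y n = RtoC 0) -> conv x y k = (x O * y k)%C.
Proof.
  revert y; induction k as [|k IH]; intros y H; [reflexivity|].
  rewrite conv_S_r, (IH (tail y)), (H O) by (intros; unfold tail; try apply H; lia).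
  unfold tail. ring.
Qed.

(** Multiply by y = 1 + conj(x_0) e z^k, where e is the phase of x_k. Entries 0 and
    k of the product have moduli |x_0| and |x_k| + |x_0|^2, while |y|^2 = 1 + |x_0|^2,
    so the multiplier bound reads |x_0|^2 + (|x_k| + |x_0|^2)^2 <= 1 + |x_0|^2. *)
Lemma schwarz_pick_coef x k :
  l1 x -> (forall z, Cmod z = 1 -> Cmod (eval x z) <= 1) -> (1 <= k)%nat ->
  Cmod (x k) <= 1 - Cmod (x O) ^ 2.
Proof.
  intros Hx Hb Hk. destruct k as [|k]; [lia|]. clear Hk.
  pose proof (Cmod_ge_0 (x O)) as P0. pose proof (Cmod_ge_0 (x (S k))) as Pk.
  pose proof (coef_0_bound x 1 Hx Rle_0_1 Hb) as C0.
  destruct (Req_dec (Cmod (x (S k))) 0) as [E|E]; [rewrite E; nra|].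
  set (e := (x (S k) / RtoC (Cmod (x (S k))))%C).
  assert (Hne : RtoC (Cmod (x (S k))) <> RtoC 0) by (intros F; apply E; injection F; auto).
  assert (He : Cmod e = 1).
  { unfold e. rewrite Cmod_div, Cmod_R, Rabs_pos_eq by auto. field; auto. }
  assert (Hxe : (RtoC (Cmod (x (S k))) * e = x (S k))%C) by (unfold e; field; auto).
  set (y := fun n => match n with O => RtoC 1
            | _ => if Nat.eqb n (S k) then (Cconj (x O) * e)%C else RtoC 0 end).
  assert (Y0 : y O = RtoC 1) by reflexivity.
  assert (Yk : y (S k) = (Cconj (x O) * e)%C) by (unfold y; rewrite Nat.eqb_refl; auto).
  assert (Yn : forall n, (n < k)%nat -> tail y n = RtoC 0).
  { intros n Hn. unfold tail, y. destruct (Nat.eqb_spec (S n) (S k)); [lia|reflexivity]. }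
  pose proof (multiplier_contraction x 1 y (S (S k)) Hx Rle_0_1 Hb) as H.
  assert (Hck : Cmod (conv x y (S k)) = Cmod (x (S k)) + Cmod (x O) ^ 2).
  { rewrite conv_S_r, conv_single by auto. unfold tail at 1. rewrite Yk, Y0.
    replace (x O * (Cconj (x O) * e) + x (S k) * 1)%C
      with (RtoC (Cmod (x O) ^ 2 + Cmod (x (S k))) * e)%C.
    - rewrite Cmod_mult, He, Cmod_R, Rabs_pos_eq; nra.
    - rewrite RtoC_plus, Cmod2_conj.
      transitivity (x O * Cconj (x O) * e + RtoC (Cmod (x (S k))) * e)%C; [ring|].
      rewrite Hxe. ring. }
  change (rsum (fun n => Cmod (conv x y n) ^ 2) (S (S k)))
    with (rsum (fun n => Cmod (conv x y n) ^ 2) (S k) + Cmod (conv x y (S k)) ^ 2) in H.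
  change (rsum (fun n => Cmod (y n) ^ 2) (S (S k)))
    with (rsum (fun n => Cmod (y n) ^ 2) (S k) + Cmod (y (S k)) ^ 2) in H.
  pose proof (term_le_rsum (fun n => Cmod (conv x y n) ^ 2) 0 (S k)
               (fun n => pow2_ge_0 _) (Nat.lt_0_succ k)) as T.
  rewrite (rsum_S_l (fun n => Cmod (y n) ^ 2) k) in H.
  rewrite (rsum_ext (tail _) (fun _ => 0)), rsum_const in H.
  2:{ intros n Hn. specialize (Yn n Hn). unfold tail in *. rewrite Yn, Cmod_0. ring. }
  rewrite Hck, Y0, Yk, Cmod_1, Cmod_mult, Cmod_conj, He in H.
  cbv beta in T. simpl (conv x y 0) in T. rewrite Cmult_1_r in T.
  nra.
Qed.


(** * Division by a linear factor *)

(** Coefficients of (a(z) - a(w)) / (z - w); the n-th one is the sum of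
    a_(n+1+k) w^k over k, see [eval_divided_difference]. *)
Definition divided_difference (a : nat -> C) (w : C) (n : nat) : C :=
  eval (fun k => a (S n + k)%nat) w.

Lemma l1_bound_shift a M m : l1_bound a M -> l1_bound (fun n => a (m + n)%nat) M.
Proof.
  intros H N. specialize (H (m + N)%nat). rewrite rsum_add in H.
  pose proof (rsum_nonneg (fun n => Cmod (a n)) m (fun n => Cmod_ge_0 _)). lra.
Qed.

Lemma l1_shift a m : l1 a -> l1 (fun n => a (m + n)%nat).
Proof. intros [M H]. exists M. apply l1_bound_shift, H. Qed.

Lemma divided_difference_rec a w n : l1 a -> Cmod w <= 1 -> divided_difference a w n = (a (S n) + w * divided_difference a w (S n))%C.
Proof.
  intros Ha Hw. unfold divided_difference. rewrite eval_S by (auto using l1_shift).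
  rewrite Nat.add_0_r. do 2 f_equal. apply eval_ext. intros k; unfold tail. f_equal; lia.
Qed.

(** The recursion q_n = a_(n+1) + w q_(n+1) bounds each partial sum of |q_n| by
    that of |a_n| plus |w| times itself, up to one boundary term. *)
Lemma l1_bound_divided_difference a M w :
  l1_bound a M -> Cmod w < 1 -> l1_bound (divided_difference a w) (2 * M / (1 - Cmod w)).
Proof.
  intros Ha Hw N. pose proof (Cmod_ge_0 w) as Pw.
  set (q := fun n => Cmod (divided_difference a w n)).
  assert (B : q N <= M) by (apply eval_bound; [apply l1_bound_shift, Ha|lra]).
  assert (T : rsum (fun n => q (S n)) N <= rsum q N + q N).
  { change (rsum q N + q N) with (rsum q (S N)). rewrite rsum_S_l. unfold tail.
    assert (0 <= q O) by apply Cmod_ge_0. lra. }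
  assert (E : rsum q N <= rsum (fun n => Cmod (tail a n)) N + Cmod w * rsum (fun n => q (S n)) N).
  { rewrite <- rsum_scal, <- rsum_plus. apply rsum_le. intros n _. unfold q.
    rewrite divided_difference_rec by (try (exists M; assumption); lra).
    eapply Rle_trans; [apply Cmod_triangle|]. rewrite Cmod_mult. unfold tail. lra. }
  pose proof (l1_bound_tail _ _ Ha N) as HT. simpl in HT.
  assert (0 <= q N) by apply Cmod_ge_0.
  apply Rle_div_r; [lra|]. fold q. nra.
Qed.

Lemma l1_divided_difference a w : l1 a -> Cmod w < 1 -> l1 (divided_difference a w).
Proof. intros [M H] Hw. eexists; apply l1_bound_divided_difference; eassumption. Qed.

Lemma eval_divided_difference a w z :
  l1 a -> Cmod w < 1 -> Cmod z <= 1 ->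
  (eval a z - eval a w = (z - w) * eval (divided_difference a w) z)%C.
Proof.
  intros Ha Hw Hz. pose proof (l1_divided_difference a w Ha Hw) as Hq.
  assert (E : eval (divided_difference a w) z = (eval (tail a) z + w * eval (tail (divided_difference a w)) z)%C).
  { rewrite (eval_ext (divided_difference a w) (fun n => tail a n + w * tail (divided_difference a w) n)%C).
    - rewrite eval_plus, eval_scal; auto using l1_tail, l1_scal.
    - intros n. apply divided_difference_rec; auto; lra. }
  rewrite (eval_S a w), (eval_S a z) by (auto; lra).
  assert (Q0 : eval (tail a) w = divided_difference a w O) by (apply eval_ext; reflexivity).
  rewrite Q0.
  assert (E2 : (z * eval (tail (divided_difference a w)) z = eval (divided_difference a w) z - divided_difference a w O)%C).
  { rewrite (eval_S (divided_difference a w) z) by auto. ring. }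
  transitivity (z * eval (tail a) z - w * divided_difference a w O)%C; [ring|].
  replace (z * eval (tail a) z)%C
    with (z * eval (divided_difference a w) z - w * (z * eval (tail (divided_difference a w)) z))%C by (rewrite E at 1; ring).
  rewrite E2. ring.
Qed.

Lemma eval_lipschitz a M t z w :
  l1_bound a M -> t < 1 -> Cmod z <= 1 -> Cmod w <= t ->
  Cmod (eval a z - eval a w) <= 2 * M / (1 - t) * Cmod (z - w).
Proof.
  intros Ha Ht Hz Hw. assert (l1 a) by (exists M; auto).
  pose proof (l1_bound_nonneg _ _ Ha).
  rewrite eval_divided_difference, Cmod_mult, Rmult_comm by (auto; lra).
  apply Rmult_le_compat_r; [apply Cmod_ge_0|].
  apply Rle_trans with (2 * M / (1 - Cmod w)).
  - apply eval_bound; auto. apply l1_bound_divided_difference; [auto|lra].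
  - apply Rmult_le_compat_l; [lra|]. apply Rinv_le_contravar; lra.
Qed.

(** Continuity of both sides at an interior point, in the quantitative form of
    [eval_lipschitz]. It restores a domination that was divided by (z - w). *)
Lemma domination_at_point a b w :
  l1 a -> l1 b -> Cmod w < 1 ->
  (forall z, Cmod z <= 1 -> z <> w -> Cmod (eval b z) <= Cmod (eval a z)) ->
  Cmod (eval b w) <= Cmod (eval a w).
Proof.
  intros [A HA] [B HB] Hw H. apply Rnot_lt_le. intros L.
  set (g := Cmod (eval b w) - Cmod (eval a w)).
  set (La := 2 * A / (1 - Cmod w)). set (Lb := 2 * B / (1 - Cmod w)).
  pose proof (l1_bound_nonneg _ _ HA). pose proof (l1_bound_nonneg _ _ HB).
  assert (PA : 0 <= La) by (apply Rdiv_le_0_compat; lra).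
  assert (PB : 0 <= Lb) by (apply Rdiv_le_0_compat; lra).
  set (h := Rmin (1 - Cmod w) (g / (La + Lb + 1))).
  assert (Hg : 0 < g) by (unfold g; lra).
  assert (Hh : 0 < h) by (apply Rmin_glb_lt; [lra|apply Rdiv_lt_0_compat; lra]).
  assert (Hh1 : h <= 1 - Cmod w) by apply Rmin_l.
  assert (Hh2 : h * (La + Lb + 1) <= g).
  { replace g with (g / (La + Lb + 1) * (La + Lb + 1)) by (field; lra).
    apply Rmult_le_compat_r; [lra|apply Rmin_r]. }
  set (z := (w + RtoC h)%C).
  assert (Ez : Cmod (z - w) = h).
  { replace (z - w)%C with (RtoC h) by (unfold z; ring). rewrite Cmod_R. apply Rabs_pos_eq; lra. }
  assert (Hz : Cmod z <= 1).
  { unfold z. eapply Rle_trans; [apply Cmod_triangle|].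
    rewrite Cmod_R, Rabs_pos_eq; lra. }
  assert (Hzw : z <> w).
  { intros E. rewrite E in Ez. replace (w - w)%C with (RtoC 0) in Ez by ring.
    rewrite Cmod_0 in Ez. lra. }
  specialize (H z Hz Hzw).
  pose proof (eval_lipschitz a A (Cmod w) z w HA Hw Hz (Rle_refl _)) as Ia.
  pose proof (eval_lipschitz b B (Cmod w) z w HB Hw Hz (Rle_refl _)) as Ib.
  fold La in Ia. fold Lb in Ib. rewrite Ez in Ia, Ib.
  assert (Cmod (eval b w) <= Cmod (eval b z) + Cmod (eval b z - eval b w)).
  { rewrite <- (Cmod_opp (eval b z - eval b w)).
    eapply Rle_trans; [|apply Cmod_triangle]. right; f_equal; ring. }
  assert (Cmod (eval a z) <= Cmod (eval a w) + Cmod (eval a z - eval a w)).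
  { eapply Rle_trans; [|apply Cmod_triangle]. right; f_equal; ring. }
  unfold g in *. nra.
Qed.

Lemma Cmod_le_coords (x y u v : R) : Cmod ((x, y) - (u, v))%C <= Rabs (x - u) + Rabs (y - v).
Proof.
  replace ((x, y) - (u, v))%C with (RtoC (x - u) + Ci * RtoC (y - v))%C.
  - eapply Rle_trans; [apply Cmod_triangle|]. rewrite Cmod_mult, Cmod_Ci, !Cmod_R. lra.
  - unfold RtoC, Ci, Cminus, Cplus, Cmult, Copp; simpl. f_equal; ring.
Qed.

(** Compactness: each point of the square [-1,1]^2 has a radius [d] on which either
    |a| >= d by the Lipschitz bound, or the closed disk of radius [t] is avoided. A
    common lower bound of these radii bounds |a| from below. *)
Lemma zero_free_lower_bound a t :
  l1 a -> t < 1 -> (forall z, Cmod z <= t -> eval a z <> RtoC 0) ->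
  exists eta, 0 < eta /\ forall z, Cmod z <= t -> eta <= Cmod (eval a z).
Proof.
  intros [M HM] Ht Hz.
  pose proof (l1_bound_nonneg _ _ HM) as PM.
  set (L := 2 * M / (1 - t)). assert (PL : 0 <= L) by (apply Rdiv_le_0_compat; lra).
  set (d := fun u v => if Rle_dec (Cmod (u, v)) t
                       then Cmod (eval a (u, v)) / (2 * L + 1) else (Cmod (u, v) - t) / 2).
  assert (Pd : forall u v, 0 < d u v).
  { intros u v. unfold d. destruct (Rle_dec (Cmod (u, v)) t) as [l|l].
    - apply Rdiv_lt_0_compat; [|lra]. apply Cmod_gt_0, Hz, l.
    - lra. }
  destruct (compactness_value_2d (-1) 1 (-1) 1 (fun u v => mkposreal _ (Pd u v))) as [e He].
  exists e. split; [apply cond_pos|].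
  intros [x y] Hxy. apply Rnot_lt_le. intros F.
  assert (Hx : Rabs x <= 1 /\ Rabs y <= 1).
  { pose proof (Rmax_Cmod (x, y)) as Q. simpl in Q.
    pose proof (Rmax_l (Rabs x) (Rabs y)). pose proof (Rmax_r (Rabs x) (Rabs y)). lra. }
  destruct Hx as [Hx Hy]. apply Rabs_le_between in Hx. apply Rabs_le_between in Hy.
  apply (He x y); [lra|lra|]. simpl. intros (u & v & _ & _ & Hu & Hv & Hd).
  pose proof (Cmod_le_coords x y u v) as HC.
  unfold d in Hu, Hv, Hd. destruct (Rle_dec (Cmod (u, v)) t) as [l|l].
  - pose proof (eval_lipschitz a M t (x, y) (u, v) HM Ht ltac:(lra) l) as Lip. fold L in Lip.
    set (m := Cmod (eval a (u, v))) in *.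
    assert (Em : m = m / (2 * L + 1) * (2 * L + 1)) by (field; lra).
    set (k := m / (2 * L + 1)) in *.
    assert (m <= Cmod (eval a (x, y)) + Cmod (eval a (x, y) - eval a (u, v))).
    { unfold m. rewrite <- (Cmod_opp (eval a (x, y) - eval a (u, v))).
      eapply Rle_trans; [|apply Cmod_triangle]. right; f_equal; ring. }
    assert (L * Cmod ((x, y) - (u, v)) <= L * (2 * k)) by (apply Rmult_le_compat_l; lra).
    lra.
  - assert (Cmod (u, v) <= Cmod (x, y) + Cmod ((x, y) - (u, v))).
    { rewrite <- (Cmod_opp ((x, y) - (u, v))).
      eapply Rle_trans; [|apply Cmod_triangle]. right; f_equal.
      unfold Cminus, Cplus, Copp; simpl; f_equal; ring. }
    lra.
Qed.

(** * Formal inverses of zero-free series *)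

(** 1/a has constant term 1/a_0 and tail -(1/a_0) a' (1/a), a' being the tail of a.
    The k-th iterate of this equation is correct up to index k. *)
Fixpoint inverse_approx (a : nat -> C) (k : nat) : nat -> C :=
  match k with
  | O => fun _ => (/ a O)%C
  | S k' => fun n => match n with
            | O => (/ a O)%C
            | S m => (- / a O * conv (tail a) (inverse_approx a k') m)%C
            end
  end.

Lemma inverse_approx_stable a k n :
  (n <= k)%nat -> inverse_approx a (S k) n = inverse_approx a k n.
Proof.
  revert n; induction k as [|k IH]; intros n L.
  - replace n with O by lia. reflexivity.
  - destruct n as [|m]; [reflexivity|].
    change (- / a O * conv (tail a) (inverse_approx a (S k)) m
            = - / a O * conv (tail a) (inverse_approx a k) m)%C.
    f_equal. apply conv_ext; [auto|]. intros j Hj. apply IH. lia.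
Qed.

Lemma conv_inverse a : a O <> RtoC 0 -> exists i, forall n, conv i a n = series_one n.
Proof.
  intros H0. set (i := fun n => inverse_approx a n n). exists i.
  assert (St : forall k n, (n <= k)%nat -> inverse_approx a k n = i n).
  { intros k n L. induction L as [|k L IH]; [reflexivity|].
    rewrite inverse_approx_stable by lia. exact IH. }
  intros n. rewrite conv_comm. destruct n as [|m].
  - unfold i; simpl. field. auto.
  - simpl. unfold i at 1. simpl.
    rewrite (conv_ext (tail a) (tail a) (inverse_approx a m) i) by auto.
    field. auto.
Qed.

Lemma conv_cancel_l u e f :
  u O <> RtoC 0 -> (forall n, conv u e n = conv u f n) -> forall n, e n = f n.
Proof.
  intros H0 H n. destruct (conv_inverse u H0) as [i Hi].
  assert (E : forall g, g n = conv i (conv u g) n).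
  { intros g. rewrite <- conv_assoc. rewrite (conv_ext _ series_one g g) by auto.
    symmetry; apply conv_1_l. }
  rewrite (E e), (E f). apply conv_ext; auto.
Qed.

(** Comparison with a geometric series of ratio s/r. *)
Lemma l1_dilate_lt a B s r :
  0 <= s < r -> (forall n, Cmod (dilate r a n) <= B) -> l1 (dilate s a).
Proof.
  intros Hs HB. exists (B * / (1 - s / r)). intros N.
  assert (Px : 0 <= s / r) by (apply Rdiv_le_0_compat; lra).
  assert (Lx : s / r < 1) by (apply Rlt_div_l; lra).
  assert (PB : 0 <= B) by (eapply Rle_trans; [apply Cmod_ge_0|apply (HB O)]).
  apply Rle_trans with (rsum (fun n => B * (s / r) ^ n) N).
  - apply rsum_le. intros n _.
    replace (dilate s a n) with (dilate r a n * RtoC (s / r) ^ n)%C.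
    + rewrite Cmod_mult, Cmod_pow, Cmod_R, Rabs_pos_eq by auto.
      apply Rmult_le_compat_r; [apply pow_le; auto|auto].
    + unfold dilate. rewrite <- Cmult_assoc, <- Cpow_mult_l, <- RtoC_mult.
      do 3 f_equal. field. lra.
  - rewrite rsum_scal. apply Rmult_le_compat_l; [auto|].
    assert (E : (1 - s / r) * rsum (fun n => (s / r) ^ n) N = 1 - (s / r) ^ N).
    { induction N as [|N IH]; simpl; [ring|]. rewrite Rmult_plus_distr_l, IH. ring. }
    apply Rmult_le_reg_l with (1 - s / r); [lra|]. rewrite Rinv_r by lra.
    apply Rle_trans with (1 - (s / r) ^ N); [right; exact E|].
    pose proof (pow_le (s / r) N Px). lra.
Qed.

Lemma dilate_term_le s a n : 0 <= s <= 1 -> Cmod (dilate s a n) <= Cmod (a n).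
Proof. intros H. apply Cmod_term_le. rewrite Cmod_R, Rabs_pos_eq; lra. Qed.

Lemma l1_dilate s a : 0 <= s <= 1 -> l1 a -> l1 (dilate s a).
Proof.
  intros Hs [M H]. exists M. apply l1_bound_le with a; [|auto].
  intros n; apply dilate_term_le, Hs.
Qed.

Lemma l1_one : l1 series_one.
Proof.
  exists 1. intros [|N]; [simpl; lra|]. rewrite rsum_S_l.
  rewrite (rsum_ext (tail _) (fun _ => 0)), rsum_const.
  - simpl. rewrite Cmod_1. lra.
  - intros n _. apply Cmod_0.
Qed.

Lemma eval_one z : Cmod z <= 1 -> eval series_one z = RtoC 1.
Proof.
  intros Hz. rewrite eval_S by auto using l1_one.
  rewrite (eval_ext _ (fun n => RtoC 0 * tail series_one n)%C).
  - rewrite eval_scal by auto using l1_tail, l1_one. simpl. ring.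
  - intros n. unfold tail; simpl. ring.
Qed.

Lemma dilate_one s n : dilate s series_one n = series_one n.
Proof. unfold dilate; destruct n; simpl; ring. Qed.

(** With i the formal inverse of a, write i_s for its dilation. The series d of
    (a(sz) - a(rz)) / a(sz) satisfies i_r = i_s + d i_r, and |d| <= 1/2 on the unit
    circle. Hence the truncated square norms satisfy |i_r|^2 <= 2 |i_s|^2 + |i_r|^2 / 2:
    an a priori bound independent of the truncation. *)
Lemma inverse_growth_step a i M t eta s r :
  l1_bound a M -> t < 1 -> 0 < eta -> (forall z, Cmod z <= t -> eta <= Cmod (eval a z)) ->
  (forall n, conv i a n = series_one n) ->
  0 <= s <= t -> 0 <= r <= t -> 2 * M / (1 - t) * Rabs (s - r) <= eta / 2 ->
  l1 (dilate s i) -> exists B, forall n, Cmod (dilate r i n) <= B.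
Proof.
  intros HM Ht He Hlow Hi Hs Hr Hd Hsi.
  assert (Ha : l1 a) by (exists M; auto).
  set (is := dilate s i) in *. set (ir := dilate r i).
  set (D := fun n => (dilate s a n + RtoC (-1) * dilate r a n)%C).
  assert (HD : l1 D).
  { apply l1_plus; [|apply l1_scal]; apply l1_dilate; auto; lra. }
  set (d := conv is D). assert (Hdl : l1 d) by (apply l1_conv; auto).
  assert (Bd : forall z, Cmod z = 1 -> Cmod (eval d z) <= 1 / 2).
  { intros z Hz. unfold d. rewrite eval_conv, Cmod_mult by (auto; lra).
    assert (Cs : Cmod (RtoC s * z) <= t).
    { rewrite Cmod_mult, Hz, Cmod_R, Rabs_pos_eq; lra. }
    assert (Cr : Cmod (RtoC r * z) <= t).
    { rewrite Cmod_mult, Hz, Cmod_R, Rabs_pos_eq; lra. }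
    assert (E1 : (eval is z * eval a (RtoC s * z) = 1)%C).
    { rewrite <- eval_dilate, <- eval_conv by (auto using l1_dilate; try apply l1_dilate; auto; lra).
      rewrite <- (eval_one z) by lra. apply eval_ext. intros n. unfold is.
      rewrite conv_dilate. rewrite <- (dilate_one s n). unfold dilate. rewrite Hi. reflexivity. }
    assert (E2 : eval D z = (eval a (RtoC s * z) - eval a (RtoC r * z))%C).
    { unfold D. rewrite eval_plus, eval_scal, !eval_dilate; try lra; try apply l1_scal;
        try apply l1_dilate; auto; try lra. ring. }
    rewrite E2.
    pose proof (eval_lipschitz a M t _ _ HM Ht (Rle_trans _ _ _ Cs (Rlt_le _ _ Ht)) Cr) as Lip.
    replace (RtoC s * z - RtoC r * z)%C with (RtoC (s - r) * z)%C in Lip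
      by (rewrite RtoC_minus; ring).
    rewrite Cmod_mult, Hz, Cmod_R, Rmult_1_r in Lip.
    apply (f_equal Cmod) in E1. rewrite Cmod_mult, Cmod_1 in E1.
    specialize (Hlow _ Cs). pose proof (Cmod_ge_0 (eval is z)).
    set (p := Cmod (eval is z)) in *. set (q := Cmod (eval a (RtoC s * z))) in *.
    apply Rle_trans with (p * (eta / 2)); [apply Rmult_le_compat_l; lra|].
    assert (p * eta <= p * q) by (apply Rmult_le_compat_l; lra). lra. }
  (* 1/a(rz) - 1/a(sz) = (a(sz) - a(rz)) / (a(sz) a(rz)) on the level of coefficients *)
  assert (Id : forall n, ir n = (is n + conv d ir n)%C).
  { intros n. unfold d. rewrite conv_assoc.
    assert (E : forall k, conv D ir k = (conv (dilate s a) ir k + RtoC (-1) * series_one k)%C).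
    { intros k. unfold D, ir. rewrite conv_plus_l, conv_scal_l. do 2 f_equal.
      rewrite conv_dilate. rewrite <- (dilate_one r k). unfold dilate. do 1 f_equal.
      rewrite conv_comm. apply Hi. }
    rewrite (conv_ext is is _ (fun k => conv (dilate s a) ir k + RtoC (-1) * series_one k)%C) by auto.
    rewrite (conv_comm is), conv_plus_l, conv_scal_l, conv_1_l.
    rewrite (conv_comm (conv _ _) is), <- conv_assoc.
    rewrite (conv_ext (conv is (dilate s a)) series_one ir ir).
    - rewrite conv_1_l. ring.
    - intros k _. unfold is. rewrite conv_dilate, <- (dilate_one s k).
      unfold dilate. rewrite Hi. reflexivity.
    - auto. }
  destruct Hsi as [B HB]. exists (2 * B). intros n.
  pose proof (l1_bound_nonneg _ _ HB) as PB.
  pose proof (multiplier_contraction d (1 / 2) ir (S n) Hdl ltac:(lra) Bd) as MC.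
  set (X := rsum (fun n => Cmod (ir n) ^ 2) (S n)) in *.
  assert (HX : X <= 2 * rsum (fun n => Cmod (is n) ^ 2) (S n)
                    + 2 * rsum (fun n => Cmod (conv d ir n) ^ 2) (S n)).
  { rewrite <- !rsum_scal, <- rsum_plus. apply rsum_le. intros k _. cbv beta.
    rewrite (Id k) at 1. pose proof (Cmod_triangle (is k) (conv d ir k)) as T.
    pose proof (Cmod_ge_0 (is k + conv d ir k)).
    assert (Cmod (is k + conv d ir k) ^ 2 <= (Cmod (is k) + Cmod (conv d ir k)) ^ 2)
      by (apply pow_incr; lra).
    pose proof (pow2_ge_0 (Cmod (is k) - Cmod (conv d ir k))). nra. }
  assert (HY : rsum (fun n => Cmod (is n) ^ 2) (S n) <= B * B).
  { apply Rle_trans with (rsum (fun k => B * Cmod (is k)) (S n)).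
    - apply rsum_le. intros k _. pose proof (l1_bound_term _ _ k HB).
      pose proof (Cmod_ge_0 (is k)). nra.
    - rewrite rsum_scal. apply Rmult_le_compat_l; [auto|apply HB]. }
  pose proof (term_le_rsum (fun n => Cmod (ir n) ^ 2) n (S n) (fun n => pow2_ge_0 _)
               (Nat.lt_succ_diag_r n)) as T. fold X in T. cbv beta in T.
  pose proof (Cmod_ge_0 (ir n)). nra.
Qed.

(** Radii are reached from 0 in steps of del/2. A step of [inverse_growth_step] may
    have length del; the surplus turns boundedness of the coefficients into
    summability. *)
Lemma inverse_summable a i t s :
  l1 a -> t < 1 -> (forall z, Cmod z <= t -> eval a z <> RtoC 0) ->
  (forall n, conv i a n = series_one n) -> 0 <= s < t -> l1 (dilate s i).
Proof.
  intros Ha Ht Hz Hi. destruct (zero_free_lower_bound a t Ha Ht Hz) as (eta & He & Hlow).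
  destruct Ha as [M HM]. pose proof (l1_bound_nonneg _ _ HM) as PM.
  set (L := 2 * M / (1 - t)). assert (PL : 0 <= L) by (apply Rdiv_le_0_compat; lra).
  set (del := eta / (2 * (L + 1))).
  assert (Pdel : 0 < del) by (apply Rdiv_lt_0_compat; lra).
  assert (Ldel : L * del <= eta / 2).
  { assert ((L + 1) * del = eta / 2) by (unfold del; field; lra). nra. }
  assert (K : forall k s, 0 <= s < t -> s <= INR k * (del / 2) -> l1 (dilate s i)).
  { induction k as [|k IH]; intros s' Hs Hk.
    - simpl in Hk. replace s' with 0 by lra. exists (Cmod (i O)). intros [|N].
      + apply Cmod_ge_0.
      + rewrite rsum_S_l, (rsum_ext (tail _) (fun _ => 0)), rsum_const.
        * unfold dilate; simpl. rewrite Cmult_1_r. lra.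
        * intros n _. unfold tail, dilate. rewrite Cpow_S, Cmult_0_l, Cmult_0_r. apply Cmod_0.
    - rewrite S_INR in Hk. set (s0 := Rmax 0 (s' - del / 2)).
      assert (Hs0 : 0 <= s0 <= s' /\ s' - s0 <= del / 2 /\ s0 <= INR k * (del / 2)).
      { pose proof (pos_INR k). unfold s0, Rmax. destruct (Rle_dec 0 (s' - del / 2)); nra. }
      destruct Hs0 as (H0 & H1 & H2).
      (* a radius beyond s', below t and within one step of s0 *)
      set (r := Rmin ((s' + t) / 2) (s0 + del)).
      assert (Hr : s' < r /\ r < t /\ r <= s0 + del).
      { unfold r, Rmin. destruct (Rle_dec ((s' + t) / 2) (s0 + del)); lra. }
      destruct Hr as (R1 & R2 & R3).
      destruct (inverse_growth_step a i M t eta s0 r HM Ht He Hlow Hi) as [B HB]; try lra.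
      + fold L. apply Rle_trans with (L * del); [|auto]. apply Rmult_le_compat_l; [auto|].
        rewrite Rabs_minus_sym, Rabs_pos_eq; lra.
      + apply IH; lra.
      + apply l1_dilate_lt with B r; [lra|auto]. }
  intros Hs. destruct (INR_unbounded (2 / del)) as [k Hk].
  apply (K k s Hs). assert (2 / del * (del / 2) = 1) by (field; lra).
  assert (2 / del * (del / 2) <= INR k * (del / 2)) by (apply Rmult_le_compat_r; lra). lra.
Qed.

(** Here c = b (1/a) is summable at radius [s], and of modulus at most 1 there. *)
Lemma zero_free_coef_bound a b c t s k :
  l1 a -> l1 b -> (forall z, Cmod z <= 1 -> Cmod (eval b z) <= Cmod (eval a z)) ->
  (forall n, conv c a n = b n) -> t < 1 -> (forall z, Cmod z <= t -> eval a z <> RtoC 0) ->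
  0 <= s < t -> (1 <= k)%nat ->
  Cmod (c k) * s ^ k <= 1 - Cmod (c O) ^ 2.
Proof.
  intros Ha Hb Hdom Hc Ht Hz Hs Hk.
  assert (a0 : a O <> RtoC 0).
  { intros E. apply (Hz (RtoC 0)); [rewrite Cmod_0; lra|].
    rewrite eval_S by (auto; rewrite Cmod_0; lra). rewrite E. ring. }
  destruct (conv_inverse a a0) as [i Hi].
  assert (Ec : forall n, dilate s c n = conv (dilate s b) (dilate s i) n).
  { intros n. rewrite conv_dilate. unfold dilate. f_equal.
    rewrite (conv_ext b (conv c a) i i) by auto. rewrite conv_assoc.
    rewrite (conv_ext c c (conv a i) series_one); [rewrite conv_1_r; auto|auto|].
    intros m _. rewrite conv_comm. apply Hi. }
  assert (Hcl : l1 (dilate s c)).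
  { destruct (l1_conv (dilate s b) (dilate s i)) as [M HM].
    - apply l1_dilate; [lra|auto].
    - apply inverse_summable with a t; auto.
    - exists M. apply l1_bound_le with (2 := HM). intros n. rewrite Ec. lra. }
  assert (B : forall z, Cmod z = 1 -> Cmod (eval (dilate s c) z) <= 1).
  { intros z Hz1. assert (Cs : Cmod (RtoC s * z) <= t).
    { rewrite Cmod_mult, Hz1, Cmod_R, Rabs_pos_eq; lra. }
    assert (E : (eval (dilate s c) z * eval a (RtoC s * z) = eval b (RtoC s * z))%C).
    { rewrite <- !eval_dilate, <- eval_conv by (first [assumption | lra | apply l1_dilate; [lra|assumption]]).
      apply eval_ext. intros n. rewrite conv_dilate. unfold dilate. rewrite Hc. reflexivity. }
    pose proof (Hdom (RtoC s * z)%C ltac:(lra)) as Hd.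
    rewrite <- E, Cmod_mult in Hd. specialize (Hz _ Cs). apply Cmod_gt_0 in Hz. nra. }
  pose proof (schwarz_pick_coef (dilate s c) k Hcl B Hk) as SP.
  unfold dilate in SP. rewrite Cmod_mult, Cmod_pow, Cmod_R, Rabs_pos_eq in SP by lra.
  simpl (RtoC s ^ 0)%C in SP. rewrite Cmult_1_r in SP. exact SP.
Qed.

(** * Removal of zeros and the coefficient bound *)

Definition linear_series (p q : C) : nat -> C :=
  fun n => match n with O => p | 1%nat => q | _ => RtoC 0 end.

Lemma l1_linear p q : l1 (linear_series p q).
Proof.
  exists (Cmod p + Cmod q). pose proof (Cmod_ge_0 p). pose proof (Cmod_ge_0 q).
  intros [|[|N]]; [simpl; lra|simpl; lra|].
  rewrite !rsum_S_l. rewrite (rsum_ext (tail _) (fun _ => 0)), rsum_const.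
  - unfold tail; simpl. lra.
  - intros n _. apply Cmod_0.
Qed.

Lemma eval_linear p q z : Cmod z <= 1 -> eval (linear_series p q) z = (p + q * z)%C.
Proof.
  intros Hz. rewrite eval_S by (auto using l1_linear).
  rewrite (eval_ext (tail _) (fun n => q * series_one n)%C).
  - rewrite eval_scal, eval_one by auto using l1_one. simpl; ring.
  - intros [|n]; unfold tail; simpl; ring.
Qed.

Lemma factor_root a w n :
  l1 a -> Cmod w < 1 -> eval a w = RtoC 0 ->
  a n = conv (linear_series (- w) 1) (divided_difference a w) n.
Proof.
  intros Ha Hw E. destruct n as [|n].
  - simpl. rewrite eval_S in E by (auto; lra).
    assert (Q : eval (tail a) w = divided_difference a w O) by (apply eval_ext; reflexivity).
    rewrite Q in E. transitivity ((a O + w * divided_difference a w O) - w * divided_difference a w O)%C; [ring|].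
    rewrite E. ring.
  - simpl. rewrite (conv_ext (tail (linear_series (- w) 1)) series_one (divided_difference a w) (divided_difference a w)); auto.
    rewrite conv_1_l, (divided_difference_rec a w n) by (auto; lra). ring.
Qed.

(** Induction on the number [K] of zeros that may remain in |z| <= t. If a(w) = 0,
    replace a by a (1 - conj(w) z) / (z - w), and b likewise: the quotient c is
    unchanged, as is |a| on the unit circle, while |a_0| is divided by |w| <= t. For
    K = 0 the hypothesis M < |a_0| contradicts the mean value bound [coef_0_bound]. *)
Lemma coef_bound_by_zero_removal K : forall a b c M t s k,
  l1 a -> l1 b -> (forall z, Cmod z <= 1 -> Cmod (eval b z) <= Cmod (eval a z)) ->
  (forall n, conv c a n = b n) -> 0 < t < 1 ->
  (forall z, Cmod z = 1 -> Cmod (eval a z) <= M) -> M * t ^ K < Cmod (a O) ->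
  0 <= s < t -> (1 <= k)%nat ->
  Cmod (c k) * s ^ k <= 1 - Cmod (c O) ^ 2.
Proof.
  induction K as [|K IH]; intros a b c M t s k Ha Hb Hdom Hc Ht HM HK Hs Hk.
  - exfalso. rewrite pow_O, Rmult_1_r in HK.
    assert (PM : 0 <= M) by (eapply Rle_trans; [apply Cmod_ge_0|apply (HM (RtoC 1)), Cmod_1]).
    pose proof (coef_0_bound a M Ha PM HM). lra.
  - destruct (classic (exists w, Cmod w <= t /\ eval a w = RtoC 0))
      as [(w & Hw & Ew)|Hn].
    2:{ apply zero_free_coef_bound with a b t; auto; try lra.
        intros z Hz E. apply Hn. exists z; auto. }
    assert (Hw1 : Cmod w < 1) by lra.
    assert (PM : 0 <= M) by (eapply Rle_trans; [apply Cmod_ge_0|apply (HM (RtoC 1)), Cmod_1]).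
    assert (Pa : 0 < Cmod (a O)).
    { eapply Rle_lt_trans; [|exact HK]. apply Rmult_le_pos; [auto|apply pow_le; lra]. }
    assert (Ebw : eval b w = RtoC 0).
    { apply Cmod_eq_0. specialize (Hdom w ltac:(lra)). rewrite Ew, Cmod_0 in Hdom.
      pose proof (Cmod_ge_0 (eval b w)). lra. }
    set (qa := divided_difference a w). set (qb := divided_difference b w).
    assert (Hqa : l1 qa) by (apply l1_divided_difference; auto).
    assert (Hqb : l1 qb) by (apply l1_divided_difference; auto).
    set (B := linear_series 1 (- Cconj w)).
    assert (Fa : forall z, Cmod z <= 1 -> eval a z = ((z - w) * eval qa z)%C).
    { intros z Hz. unfold qa. rewrite <- eval_divided_difference, Ew by auto. ring. }
    assert (Fb : forall z, Cmod z <= 1 -> eval b z = ((z - w) * eval qb z)%C).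
    { intros z Hz. unfold qb. rewrite <- eval_divided_difference, Ebw by auto. ring. }
    assert (A0 : a O = (- w * qa O)%C).
    { rewrite (factor_root a w O); auto. }
    assert (w0 : w <> RtoC 0).
    { intros E. rewrite A0, E in Pa. replace (- 0 * qa O)%C with (RtoC 0) in Pa by ring.
      rewrite Cmod_0 in Pa. lra. }
    assert (Dq : forall z, Cmod z <= 1 -> z <> w -> Cmod (eval qb z) <= Cmod (eval qa z)).
    { intros z Hz Hzw. specialize (Hdom z Hz). rewrite Fa, Fb, !Cmod_mult in Hdom by auto.
      assert (0 < Cmod (z - w)).
      { apply Cmod_gt_0. intros E. apply Hzw. replace z with ((z - w) + w)%C by ring.
        rewrite E. ring. }
      apply Rmult_le_reg_l with (Cmod (z - w)); auto. }
    assert (Dw : Cmod (eval qb w) <= Cmod (eval qa w)) by (apply domination_at_point; auto).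
    (* the relation b = c a survives division by z - w, which is invertible as a
       formal power series because w <> 0 *)
    assert (Cq : forall n, conv c qa n = qb n).
    { apply conv_cancel_l with (linear_series (- w) 1).
      - simpl. intros E. apply w0. replace w with (- - w)%C by ring. rewrite E. ring.
      - intros n. 
        rewrite (conv_ext _ (linear_series (- w) 1) (conv c qa) (conv qa c)) by
          (auto; intros; apply conv_comm).
        rewrite <- conv_assoc.
        rewrite (conv_ext _ a c c) by (auto; intros; symmetry; apply factor_root; auto).
        rewrite conv_comm, Hc. apply factor_root; auto. }
    apply (IH (conv B qa) (conv B qb) c M t s k); auto; try lra.
    + apply l1_conv; [apply l1_linear|auto].
    + apply l1_conv; [apply l1_linear|auto].
    + intros z Hz. rewrite !eval_conv, !Cmod_mult by (auto; apply l1_linear).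
      apply Rmult_le_compat_l; [apply Cmod_ge_0|].
      destruct (classic (z = w)) as [->|Hzw]; auto.
    + intros n. rewrite <- conv_assoc, (conv_ext (conv c B) (conv B c) qa qa), conv_assoc;
        auto using conv_comm. apply conv_ext; auto.
    + intros z Hz. specialize (HM z Hz).
      rewrite Fa, Cmod_mult in HM by lra. rewrite eval_conv, Cmod_mult by (auto; try apply l1_linear; lra).
      replace (Cmod (eval B z)) with (Cmod (z - w)); auto.
      (* on the unit circle 1 - conj(w) z = z conj(z - w) *)
      unfold B. rewrite eval_linear by lra.
      replace (1 + - Cconj w * z)%C with (z * Cconj (z - w))%C.
      * rewrite Cmod_mult, Cmod_conj, Hz. ring.
      * rewrite Cminus_conj. unfold Cminus. rewrite Cmult_plus_distr_l.
        rewrite <- Cmod2_conj, Hz. rewrite pow1. ring.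
    + simpl (conv B qa 0). rewrite Cmult_1_l.
      rewrite A0, Cmod_mult, Cmod_opp in HK. simpl in HK.
      pose proof (Cmod_ge_0 (qa O)).
      apply Rmult_lt_reg_l with t; [lra|].
      apply Rle_lt_trans with (M * (t * t ^ K)); [right; ring|].
      eapply Rlt_le_trans; [exact HK|]. apply Rmult_le_compat_r; auto.
Qed.

Lemma bernoulli_sub h k : 0 <= h <= 1 -> 1 - INR k * h <= (1 - h) ^ k.
Proof.
  intros Hh. induction k as [|k IH]; [simpl; lra|].
  rewrite S_INR. simpl. pose proof (pos_INR k).
  apply Rle_trans with ((1 - h) * (1 - INR k * h)); [nra|]. apply Rmult_le_compat_l; lra.
Qed.

(** Letting s tend to 1, in the quantitative form of Bernoulli's inequality. *)
Lemma pow_limit_le x y k :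
  0 <= x -> (forall s, 0 <= s < 1 -> x * s ^ k <= y) -> x <= y.
Proof.
  intros Px H. apply Rnot_lt_le. intros L.
  set (h := Rmin 1 ((x - y) / (2 * (x * INR k + 1)))).
  pose proof (pos_INR k) as Pk. assert (0 <= x * INR k) by nra.
  assert (Hh : 0 < h) by (apply Rmin_glb_lt; [lra|apply Rdiv_lt_0_compat; lra]).
  assert (Hh1 : h <= 1) by apply Rmin_l.
  assert (Hh2 : h * (x * INR k + 1) <= (x - y) / 2).
  { replace ((x - y) / 2) with ((x - y) / (2 * (x * INR k + 1)) * (x * INR k + 1)) by (field; lra).
    apply Rmult_le_compat_r; [lra|apply Rmin_r]. }
  specialize (H (1 - h) ltac:(lra)).
  pose proof (bernoulli_sub h k ltac:(lra)). 
  assert (x * (1 - INR k * h) <= x * (1 - h) ^ k) by (apply Rmult_le_compat_l; auto).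
  nra.
Qed.

(** The coefficients of a quotient of modulus at most 1, whose analyticity is not
    assumed: zeros of a are allowed. *)
Lemma quotient_coef_bound a b c k :
  l1 a -> l1 b -> (forall z, Cmod z <= 1 -> Cmod (eval b z) <= Cmod (eval a z)) ->
  a O <> RtoC 0 -> (forall n, conv c a n = b n) -> (1 <= k)%nat ->
  Cmod (c k) <= 1 - Cmod (c O) ^ 2.
Proof.
  intros Ha Hb Hdom H0 Hc Hk. apply pow_limit_le with k; [apply Cmod_ge_0|].
  intros s Hs. set (t := (1 + s) / 2). destruct Ha as [M HM].
  apply Cmod_gt_0 in H0. pose proof (l1_bound_nonneg _ _ HM) as PM.
  destruct (pow_lt_1_zero t) with (y := Cmod (a O) / (M + 1)) as [K HK].
  { unfold t. rewrite Rabs_pos_eq; lra. }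
  { apply Rdiv_lt_0_compat; lra. }
  specialize (HK K (le_n _)).
  apply (coef_bound_by_zero_removal K a b c M t s k); auto; try (unfold t; lra).
  - exists M; auto.
  - intros z Hz. apply eval_bound; [auto|lra].
  - assert (P : 0 <= t ^ K) by (apply pow_le; unfold t; lra).
    rewrite Rabs_pos_eq in HK by auto.
    apply Rlt_div_r in HK; lra.
Qed.


(** * Domination in the open disk up to radius 1/3 *)

(** Equivalent to convergence of the power series in the open unit disk, see
    [analytic_on_disk] and [eval_analytic]. *)
Definition on_disk (a : nat -> C) : Prop := forall s, 0 <= s < 1 -> l1 (dilate s a).

Lemma on_disk_of_bound a :
  (forall s, 0 < s < 1 -> exists B, forall n, Cmod (dilate s a n) <= B) -> on_disk a.
Proof.
  intros H s Hs. destruct (H ((1 + s) / 2) ltac:(lra)) as [B HB].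
  apply l1_dilate_lt with B ((1 + s) / 2); [lra|auto].
Qed.

Lemma l1_on_disk a : l1 a -> on_disk a.
Proof. intros H s Hs. apply l1_dilate; [lra|auto]. Qed.

Lemma on_disk_tail a : on_disk a -> on_disk (tail a).
Proof.
  intros H. apply on_disk_of_bound. intros s Hs. destruct (H s ltac:(lra)) as [M HM].
  exists (M / s). intros n. apply Rle_div_r; [lra|].
  apply Rle_trans with (Cmod (dilate s a (S n))); [|apply l1_bound_term, HM].
  right. unfold dilate, tail. rewrite !Cmod_mult, !Cmod_pow, Cmod_R, Rabs_pos_eq by lra.
  simpl. ring.
Qed.

Lemma disk_rescale z : Cmod z < 1 ->
  exists s u, 0 < s < 1 /\ Cmod u <= 1 /\ z = (RtoC s * u)%C.
Proof.
  intros Hz. pose proof (Cmod_ge_0 z). set (s := (1 + Cmod z) / 2).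
  assert (Hs : 0 < s < 1) by (unfold s; lra).
  assert (Hn : RtoC s <> RtoC 0) by (intros E; injection E; lra).
  exists s, (z / RtoC s)%C. repeat split; try lra.
  - rewrite Cmod_div, Cmod_R, Rabs_pos_eq by (auto; lra).
    apply Rle_div_l; unfold s; lra.
  - field. auto.
Qed.

Lemma disk_eval_S a z :
  on_disk a -> Cmod z < 1 -> eval a z = (a O + z * eval (tail a) z)%C.
Proof.
  intros Ha Hz. destruct (disk_rescale z Hz) as (s & u & Hs & Hu & ->).
  rewrite <- !eval_dilate, (eval_S (dilate s a)) by (try apply Ha; lra).
  rewrite (eval_ext (tail (dilate s a)) (fun n => RtoC s * dilate s (tail a) n)%C).
  - rewrite eval_scal by (try (apply (on_disk_tail a Ha); lra); lra).
    unfold dilate at 1. simpl. ring.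
  - intros n. unfold dilate, tail. simpl. ring.
Qed.

Lemma disk_eval_scal k a z :
  on_disk a -> Cmod z < 1 -> eval (fun n => k * a n)%C z = (k * eval a z)%C.
Proof.
  intros Ha Hz. destruct (disk_rescale z Hz) as (s & u & Hs & Hu & ->).
  rewrite <- !eval_dilate.
  rewrite <- eval_scal by (try apply Ha; lra).
  apply eval_ext. intros n. unfold dilate. ring.
Qed.

Lemma eval_at_0 a : on_disk a -> eval a (RtoC 0) = a O.
Proof. intros Ha. rewrite disk_eval_S by (auto; rewrite Cmod_0; lra). ring. Qed.

(** Used after dividing two functions by z, or after the substitution w = z^2. *)
Lemma disk_domination_at_0 a b :
  on_disk a -> on_disk b ->
  (forall z, Cmod z < 1 -> z <> RtoC 0 -> Cmod (eval b z) <= Cmod (eval a z)) ->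
  forall z, Cmod z < 1 -> Cmod (eval b z) <= Cmod (eval a z).
Proof.
  intros Ha Hb H z Hz. destruct (classic (z = RtoC 0)) as [->|Hn]; [|auto].
  pose proof (domination_at_point (dilate (1 / 2) a) (dilate (1 / 2) b) (RtoC 0)) as D.
  rewrite !eval_dilate, Cmult_0_r in D. apply D.
  - apply Ha; lra.
  - apply Hb; lra.
  - rewrite Cmod_0; lra.
  - intros u Hu Hun. rewrite !eval_dilate. apply H.
    + rewrite Cmod_mult, Cmod_R, Rabs_pos_eq; lra.
    + intros E. apply Hun. apply Cmod_eq_0. apply (f_equal Cmod) in E.
      rewrite Cmod_mult, Cmod_R, Rabs_pos_eq, Cmod_0 in E; lra.
Qed.

(** Bohr's inequality: the geometric series of ratio 1/3 without its constant term
    sums to 1/2, and |c_0| + (1 - |c_0|^2) / 2 <= 1. *)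
Lemma quotient_majorant_le_1 c r N :
  (forall k, (1 <= k)%nat -> Cmod (c k) <= 1 - Cmod (c O) ^ 2) -> 0 <= r <= 1 / 3 ->
  rsum (fun n => Cmod (dilate r c n)) N <= 1.
Proof.
  intros H Hr. pose proof (Cmod_ge_0 (c O)). pose proof (Cmod_ge_0 (c 1%nat)).
  pose proof (H 1%nat (le_n _)).
  destruct N as [|N]; [simpl; lra|]. rewrite rsum_S_l.
  apply Rle_trans with (Cmod (c O) + (1 - Cmod (c O) ^ 2) * rsum (fun n => (1 / 3) * (1 / 3) ^ n) N).
  - apply Rplus_le_compat.
    + unfold dilate. simpl. rewrite Cmult_1_r. lra.
    + rewrite <- rsum_scal. apply rsum_le. intros n _. unfold tail, dilate.
      rewrite Cmod_mult, Cmod_pow, Cmod_R, Rabs_pos_eq by lra.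
      apply Rmult_le_compat; [apply Cmod_ge_0|apply pow_le; lra|apply H; lia|].
      change (r ^ S n <= (1 / 3) ^ S n). apply pow_incr; lra.
  - assert (E : rsum (fun n => (1 / 3) * (1 / 3) ^ n) N = (1 - (1 / 3) ^ N) / 2).
    { induction N as [|N IH]; simpl; [lra|]. rewrite IH. lra. }
    rewrite E. assert (0 <= (1 / 3) ^ N) by (apply pow_le; lra).
    apply Rle_trans with (Cmod (c O) + (1 - Cmod (c O) ^ 2) * (1 / 2)).
    + apply Rplus_le_compat_l, Rmult_le_compat_l; lra.
    + pose proof (pow2_ge_0 (1 - Cmod (c O))). lra.
Qed.

(** If a_0 = 0 then b_0 = 0 and both series are divided by z, which shortens the
    partial sums. Otherwise b = c a formally, and the bound of [quotient_majorant_le_1]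
    on the quotient multiplies the partial sum for a. Working with partial sums makes
    this induction cover the series a = 0 as well. *)
Lemma majorant_le_of_dominated N : forall a b r,
  on_disk a -> on_disk b ->
  (forall z, Cmod z < 1 -> Cmod (eval b z) <= Cmod (eval a z)) ->
  0 <= r <= 1 / 3 ->
  rsum (fun n => Cmod (dilate r b n)) N <= rsum (fun n => Cmod (dilate r a n)) N.
Proof.
  induction N as [|N IH]; intros a b r Ha Hb Hdom Hr; [simpl; lra|].
  assert (H00 : Cmod (b O) <= Cmod (a O)).
  { rewrite <- (eval_at_0 a), <- (eval_at_0 b) by auto. apply Hdom. rewrite Cmod_0; lra. }
  destruct (classic (a O = RtoC 0)) as [Z|Z].
  - rewrite Z, Cmod_0 in H00. pose proof (Cmod_ge_0 (b O)).
    assert (Zb : b O = RtoC 0) by (apply Cmod_eq_0; lra).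
    assert (D : forall z, Cmod z < 1 -> Cmod (eval (tail b) z) <= Cmod (eval (tail a) z)).
    { apply disk_domination_at_0; auto using on_disk_tail. intros z Hz Hn.
      specialize (Hdom z Hz). rewrite (disk_eval_S a), (disk_eval_S b), Z, Zb, !Cplus_0_l, !Cmod_mult in Hdom by auto.
      apply Cmod_gt_0 in Hn. apply Rmult_le_reg_l with (Cmod z); auto. }
    specialize (IH (tail a) (tail b) r (on_disk_tail _ Ha) (on_disk_tail _ Hb) D Hr).
    assert (E : forall x, x O = RtoC 0 ->
      rsum (fun n => Cmod (dilate r x n)) (S N) = r * rsum (fun n => Cmod (dilate r (tail x) n)) N).
    { intros x Hx. rewrite rsum_S_l, <- rsum_scal. unfold dilate at 1. rewrite Hx, Cmult_0_l, Cmod_0.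
      rewrite Rplus_0_l. apply rsum_ext. intros n _. unfold tail, dilate.
      rewrite !Cmod_mult, Cpow_S, Cmod_mult, Cmod_R, Rabs_pos_eq by lra. ring. }
    rewrite (E a Z), (E b Zb). apply Rmult_le_compat_l; lra.
  - destruct (conv_inverse a Z) as [i Hi]. set (c := conv b i).
    assert (Hc : forall n, conv c a n = b n).
    { intros n. unfold c. rewrite conv_assoc, (conv_ext b b (conv i a) series_one) by auto.
      apply conv_1_r. }
    assert (B : forall k, (1 <= k)%nat -> Cmod (c k) <= 1 - Cmod (c O) ^ 2).
    { intros k Hk. apply pow_limit_le with k; [apply Cmod_ge_0|]. intros s Hs.
      destruct (Req_dec s 0) as [->|Hs0].
      - rewrite pow_ne_zero, Rmult_0_r by lia.
        assert (E : b O = (c O * a O)%C) by (rewrite <- Hc; reflexivity).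
        rewrite E, Cmod_mult in H00. apply Cmod_gt_0 in Z. pose proof (Cmod_ge_0 (c O)).
        assert (Cmod (c O) <= 1) by nra. nra.
      - assert (E0 : dilate s c O = c O) by (unfold dilate; simpl; ring).
        replace (Cmod (c k) * s ^ k) with (Cmod (dilate s c k)).
        2:{ unfold dilate. rewrite Cmod_mult, Cmod_pow, Cmod_R, Rabs_pos_eq; lra. }
        rewrite <- E0. apply quotient_coef_bound with (dilate s a) (dilate s b); auto.
        + intros z Hz. rewrite !eval_dilate. apply Hdom.
          rewrite Cmod_mult, Cmod_R, Rabs_pos_eq by lra. pose proof (Cmod_ge_0 z). nra.
        + unfold dilate. simpl. rewrite Cmult_1_r. auto.
        + intros n. rewrite conv_dilate. unfold dilate. rewrite Hc. reflexivity. }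
    rewrite (rsum_ext _ (fun n => Cmod (conv (dilate r c) (dilate r a) n))).
    2:{ intros n _. rewrite conv_dilate. unfold dilate. rewrite Hc. reflexivity. }
    eapply Rle_trans; [apply rsum_conv_le|].
    rewrite <- (Rmult_1_l (rsum (fun n => Cmod (dilate r a n)) (S N))) at 2.
    apply Rmult_le_compat_r; [apply rsum_nonneg; intros; apply Cmod_ge_0|].
    apply quotient_majorant_le_1; auto.
Qed.

(** * Analytic functions and majorant series *)

Lemma pow_n_Cpow (z : C) n : @pow_n C_Ring z n = (z ^ n)%C.
Proof. induction n as [|n IH]; [reflexivity|]. simpl. rewrite IH. reflexivity. Qed.

Lemma is_pseries_sums a z l :
  @is_pseries C_AbsRing C_NormedModule a z l <-> sums_to (fun n => a n * z ^ n)%C l.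
Proof.
  assert (E : forall n, @scal C_AbsRing C_NormedModule (@pow_n C_AbsRing z n) (a n)
                        = (a n * z ^ n)%C).
  { intros n. change (@pow_n C_Ring z n * a n = a n * z ^ n)%C. rewrite pow_n_Cpow. ring. }
  unfold is_pseries. rewrite <- sums_to_is_series.
  split; apply sums_to_ext; intros n; rewrite E; reflexivity.
Qed.

Lemma sums_to_terms_bounded u l : sums_to u l -> exists B, forall n, Cmod (u n) <= B.
Proof.
  intros H. destruct (H 1 Rlt_0_1) as [N0 HN]. exists (2 + rsum (fun n => Cmod (u n)) N0). intros n.
  pose proof (rsum_nonneg (fun n => Cmod (u n)) N0 (fun n => Cmod_ge_0 _)).
  destruct (Nat.le_gt_cases N0 n) as [L|L].
  - pose proof (HN n L) as H1. pose proof (HN (S n) ltac:(lia)) as H2. simpl in H2.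
    replace (u n) with ((csum u n + u n - l) + - (csum u n - l))%C by ring.
    eapply Rle_trans; [apply Cmod_triangle|]. rewrite Cmod_opp. lra.
  - pose proof (term_le_rsum (fun n => Cmod (u n)) n N0 (fun n => Cmod_ge_0 _) L). simpl in *. lra.
Qed.

Lemma disk_eval_sums a z :
  on_disk a -> Cmod z < 1 -> sums_to (fun n => a n * z ^ n)%C (eval a z).
Proof.
  intros Ha Hz. apply eval_terms. destruct (Ha (Cmod z)) as [M HM].
  { split; [apply Cmod_ge_0|auto]. }
  exists M. apply l1_bound_le with (2 := HM). intros n. unfold dilate.
  rewrite !Cmod_mult, !Cmod_pow, Cmod_R, Rabs_pos_eq by apply Cmod_ge_0. lra.
Qed.

Lemma analytic_on_disk f a : analytic_in_disk f a -> on_disk a.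
Proof.
  intros H. apply on_disk_of_bound. intros s Hs.
  apply (sums_to_terms_bounded _ (f (RtoC s))).
  apply (is_pseries_sums a (RtoC s)), H. rewrite Cmod_R, Rabs_pos_eq; lra.
Qed.

Lemma analytic_eval f a z : analytic_in_disk f a -> Cmod z < 1 -> f z = eval a z.
Proof.
  intros H Hz. eapply sums_to_unique.
  - apply is_pseries_sums, H, Hz.
  - apply disk_eval_sums; [apply (analytic_on_disk f)|]; auto.
Qed.

Lemma eval_analytic a : on_disk a -> analytic_in_disk (eval a) a.
Proof. intros H z Hz. apply is_pseries_sums, disk_eval_sums; auto. Qed.

(** The index [M] is free because odd series are compared at twice the index. *)
Lemma majorant_le a b r :
  0 <= r < 1 -> on_disk a ->
  (forall N, exists M, rsum (fun n => Cmod (dilate r b n)) N <= rsum (fun n => Cmod (dilate r a n)) M) ->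
  majorant_series b r <= majorant_series a r.
Proof.
  intros Hr Ha H.
  assert (T : forall x n, Cmod (x n) * r ^ n = Cmod (dilate r x n)).
  { intros x n. unfold dilate. rewrite Cmod_mult, Cmod_pow, Cmod_R, Rabs_pos_eq; lra. }
  unfold majorant_series, PSeries.
  rewrite (Series_ext _ _ (T a)), (Series_ext _ _ (T b)).
  destruct (Ha r Hr) as [M HM].
  assert (Ea : ex_series (fun n => Cmod (dilate r a n))).
  { apply ex_series_bounded with M; [intros; apply Cmod_ge_0|apply HM]. }
  set (S := Series (fun n => Cmod (dilate r a n))).
  assert (Ba : forall N, rsum (fun n => Cmod (dilate r a n)) N <= S).
  { intros N. apply Series_correct in Ea. fold S in Ea.
    apply Rle_trans with (rsum (fun n => Cmod (dilate r a n)) (Datatypes.S N)).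
    - apply rsum_mono; [intros; apply Cmod_ge_0|lia].
    - rewrite rsum_sum_n. apply is_lim_seq_incr_compare with (u := sum_n _); [exact Ea|].
      intros n. rewrite sum_Sn. unfold plus; simpl.
      pose proof (Cmod_ge_0 (dilate r a (Datatypes.S n))). lra. }
  assert (Bb : forall N, rsum (fun n => Cmod (dilate r b n)) N <= S).
  { intros N. destruct (H N) as [K HK]. eapply Rle_trans; [exact HK|apply Ba]. }
  assert (Eb : ex_series (fun n => Cmod (dilate r b n))).
  { apply ex_series_bounded with S; [intros; apply Cmod_ge_0|apply Bb]. }
  apply Series_correct in Eb.
  apply (is_lim_seq_le (sum_n (fun n => Cmod (dilate r b n))) (fun _ => S) (Finite _) (Finite S)).
  - intros n. rewrite <- rsum_sum_n. apply Bb.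
  - exact Eb.
  - apply is_lim_seq_const.
Qed.

(** * Odd functions *)

(** The series with coefficients a_n + (-1)^n a_n vanishes identically, being
    f(z) + f(-z). *)
Lemma odd_coefs_even_zero f a n :
  analytic_in_disk f a -> odd_in_disk f -> a (2 * n)%nat = RtoC 0.
Proof.
  intros Ha Ho. pose proof (analytic_on_disk f a Ha) as Hd.
  set (x := dilate (1 / 2) a). assert (Hx : l1 x) by (apply Hd; lra).
  assert (Hx' : l1 (dilate (-1) x)).
  { destruct Hx as [M HM]. exists M. apply l1_bound_le with (2 := HM). intros k.
    apply Cmod_term_le. rewrite Cmod_R, Rabs_left; lra. }
  assert (Z : forall k, (x k + dilate (-1) x k = 0)%C).
  { apply (eval_zero_coefs (fun k => x k + dilate (-1) x k)%C).
    - apply l1_plus; auto.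
    - intros z Hz. rewrite eval_plus by (auto; lra).
      unfold x. rewrite !eval_dilate.
      assert (Hh : Cmod (RtoC (1 / 2) * z) < 1) by (rewrite Cmod_mult, Hz, Cmod_R, Rabs_pos_eq; lra).
      replace (RtoC (1 / 2) * (RtoC (-1) * z))%C with (- (RtoC (1 / 2) * z))%C by ring.
      rewrite <- !(analytic_eval f a) by (auto; rewrite Cmod_opp; auto).
      rewrite Ho by auto. ring. }
  specialize (Z (2 * n)%nat). unfold x, dilate in Z.
  rewrite Cpow_mult_r in Z. rewrite (Cpow_mult_r (RtoC (-1))) in Z.
  replace (RtoC (-1) ^ 2)%C with (RtoC 1) in Z by (simpl; ring).
  rewrite Cpow_1_l in Z.
  set (h := ((RtoC (1 / 2) ^ 2) ^ n)%C) in Z.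
  assert (Hh : h <> RtoC 0).
  { apply Cpow_nz, Cpow_nz. intros E. injection E. lra. }
  transitivity ((a (2 * n)%nat * h + a (2 * n)%nat * h * 1) / (2 * h))%C.
  - field. exact Hh.
  - rewrite Z. field. exact Hh.
Qed.

Definition odd_part (a : nat -> C) : nat -> C := fun n => a (2 * n + 1)%nat.

Lemma on_disk_odd_part a : on_disk a -> on_disk (odd_part a).
Proof.
  intros H. apply on_disk_of_bound. intros s Hs.
  assert (Q : 0 < sqrt s) by (apply sqrt_lt_R0; lra).
  assert (Q2 : sqrt s * sqrt s = s) by (apply sqrt_sqrt; lra).
  destruct (H (sqrt s)) as [M HM]. { split; nra. }
  exists (M / sqrt s). intros n. apply Rle_div_r; [auto|].
  apply Rle_trans with (Cmod (dilate (sqrt s) a (2 * n + 1))); [|apply l1_bound_term, HM].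
  right. unfold dilate, odd_part. rewrite !Cmod_mult, !Cmod_pow, !Cmod_R, !Rabs_pos_eq by lra.
  rewrite pow_add, pow_mult. replace (sqrt s ^ 2) with s by (simpl; lra). ring.
Qed.

Lemma odd_part_partial_sums a z N :
  (forall n, a (2 * n)%nat = RtoC 0) ->
  csum (fun n => a n * z ^ n)%C (2 * N) = (z * csum (fun n => odd_part a n * (z * z) ^ n) N)%C.
Proof.
  intros H. induction N as [|N IH]; [simpl; ring|].
  replace (2 * S N)%nat with (S (S (2 * N))) by lia.
  change (csum (fun n => a n * z ^ n)%C (S (S (2 * N))))
    with (csum (fun n => a n * z ^ n)%C (2 * N) + a (2 * N)%nat * z ^ (2 * N)
          + a (S (2 * N)) * z ^ S (2 * N))%C.
  assert (EN : odd_part a N = a (S (2 * N))) by (unfold odd_part; f_equal; lia).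
  rewrite IH, H. cbn [csum]. rewrite EN, Cpow_S, Cpow_mult_r. replace (z ^ 2)%C with (z * z)%C by (simpl; ring). ring.
Qed.

Lemma odd_part_majorant_sums a r N :
  (forall n, a (2 * n)%nat = RtoC 0) -> 0 <= r ->
  rsum (fun n => Cmod (dilate r a n)) (2 * N)
  = r * rsum (fun n => Cmod (dilate (r * r) (odd_part a) n)) N.
Proof.
  intros H Hr. induction N as [|N IH]; [simpl; ring|].
  replace (2 * S N)%nat with (S (S (2 * N))) by lia.
  change (rsum (fun n => Cmod (dilate r a n)) (S (S (2 * N))))
    with (rsum (fun n => Cmod (dilate r a n)) (2 * N) + Cmod (dilate r a (2 * N))
          + Cmod (dilate r a (S (2 * N)))).
  assert (EN : odd_part a N = a (S (2 * N))) by (unfold odd_part; f_equal; lia).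
  assert (E0 : Cmod (dilate r a (2 * N)) = 0) by (unfold dilate; rewrite H, Cmult_0_l; apply Cmod_0).
  assert (E1 : Cmod (dilate r a (S (2 * N))) = r * Cmod (dilate (r * r) (odd_part a) N)).
  2:{ rewrite IH, E0, E1. cbn [rsum]. ring. }
  unfold dilate. rewrite EN, !Cmod_mult, !Cmod_pow, !Cmod_R, !Rabs_pos_eq by nra.
  change (r ^ S (2 * N)) with (r * r ^ (2 * N)). rewrite pow_mult. replace (r ^ 2) with (r * r) by (simpl; ring). ring.
Qed.

Lemma eval_odd_part a z :
  on_disk a -> (forall n, a (2 * n)%nat = RtoC 0) -> Cmod z < 1 ->
  eval a z = (z * eval (odd_part a) (z * z))%C.
Proof.
  intros Ha H Hz. pose proof (Cmod_ge_0 z).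
  assert (Hzz : Cmod (z * z) < 1) by (rewrite Cmod_mult; nra).
  apply Cmod_sub_eq. intros eps He.
  pose proof (disk_eval_sums a z Ha Hz) as S1.
  pose proof (sums_to_scal z _ _ (disk_eval_sums _ _ (on_disk_odd_part a Ha) Hzz)) as S2.
  destruct (S1 (eps / 2) ltac:(lra)) as [N1 H1]. destruct (S2 (eps / 2) ltac:(lra)) as [N2 H2].
  specialize (H1 (2 * (N1 + N2))%nat ltac:(lia)). specialize (H2 (N1 + N2)%nat ltac:(lia)).
  rewrite csum_scal, <- odd_part_partial_sums in H2 by auto.
  set (c := csum _ _) in *.
  replace (eval a z - z * eval (odd_part a) (z * z))%C
    with (- (c - eval a z) + (c - z * eval (odd_part a) (z * z)))%C by ring.
  eapply Rle_trans; [apply Cmod_triangle|]. rewrite Cmod_opp. lra.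
Qed.

(** The square root of w with real part sqrt((|w| + x) / 2). *)
Lemma Csqrt_exists (w : C) : exists z : C, (z * z)%C = w.
Proof.
  destruct w as [x y]. set (m := sqrt (x * x + y * y)).
  assert (Hm : m * m = x * x + y * y) by (apply sqrt_sqrt; nra).
  assert (Pm : 0 <= m) by apply sqrt_pos.
  assert (P1 : 0 <= (m + x) / 2) by nra. assert (P2 : 0 <= (m - x) / 2) by nra.
  set (p := sqrt ((m + x) / 2)). set (q := sqrt ((m - x) / 2)).
  assert (Hp : p * p = (m + x) / 2) by (apply sqrt_sqrt; auto).
  assert (Hq : q * q = (m - x) / 2) by (apply sqrt_sqrt; auto).
  assert (Pp : 0 <= p) by apply sqrt_pos. assert (Pq : 0 <= q) by apply sqrt_pos.
  assert (Hpq : (2 * p * q) * (2 * p * q) = y * y).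
  { replace ((2 * p * q) * (2 * p * q)) with (4 * (p * p) * (q * q)) by ring.
    rewrite Hp, Hq. lra. }
  assert (Ppq : 0 <= 2 * p * q) by (apply Rmult_le_pos; lra).
  destruct (Rle_dec 0 y) as [Hy|Hy].
  - exists (p, q). unfold Cmult; simpl. f_equal; [lra|]. nra.
  - exists (p, - q). unfold Cmult; simpl. f_equal; [lra|]. nra.
Qed.

Lemma odd_majorant_le f g a b r :
  analytic_in_disk f a -> analytic_in_disk g b -> odd_in_disk f -> odd_in_disk g ->
  dominated_in_disk g f -> 0 <= r -> r * r <= 1 / 3 ->
  majorant_series b r <= majorant_series a r.
Proof.
  intros Hf Hg Of Og Hdom Hr Hr2.
  pose proof (analytic_on_disk f a Hf) as Ha. pose proof (analytic_on_disk g b Hg) as Hb.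
  pose proof (fun n => odd_coefs_even_zero f a n Hf Of) as Za.
  pose proof (fun n => odd_coefs_even_zero g b n Hg Og) as Zb.
  assert (D : forall w, Cmod w < 1 -> Cmod (eval (odd_part b) w) <= Cmod (eval (odd_part a) w)).
  { apply disk_domination_at_0; auto using on_disk_odd_part. intros w Hw Hn.
    destruct (Csqrt_exists w) as [z <-]. rewrite Cmod_mult in Hw. pose proof (Cmod_ge_0 z).
    assert (Hz : Cmod z < 1) by nra.
    specialize (Hdom z Hz).
    rewrite (analytic_eval g b), (analytic_eval f a), (eval_odd_part a), (eval_odd_part b), !Cmod_mult in Hdom by auto.
    assert (0 < Cmod z).
    { apply Cmod_gt_0. intros E. apply Hn. rewrite E. ring. }
    apply Rmult_le_reg_l with (Cmod z); auto. }
  apply majorant_le; auto; [nra|]. intros N. exists (2 * N)%nat.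
  apply Rle_trans with (rsum (fun n => Cmod (dilate r b n)) (2 * N)).
  { apply rsum_mono; [intros; apply Cmod_ge_0|lia]. }
  rewrite !odd_part_majorant_sums by auto. apply Rmult_le_compat_l; [auto|].
  apply majorant_le_of_dominated; auto using on_disk_odd_part. nra.
Qed.

(** * Sharpness *)

(** Coefficients of 1 / (1 - al z^2). *)
Fixpoint even_geometric (al : R) (n : nat) : R :=
  match n with O => 1 | 1%nat => 0 | S (S m) => al * even_geometric al m end.

Lemma even_geometric_bound al n : 0 <= al <= 1 -> 0 <= even_geometric al n <= 1.
Proof.
  intros H. assert (K : 0 <= even_geometric al n <= 1 /\ 0 <= even_geometric al (S n) <= 1).
  { induction n as [|n [IH1 IH2]]; [simpl; lra|]. split; [auto|]. simpl. nra. }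
  apply K.
Qed.

Lemma bounded_on_disk a B : (forall n, Cmod (a n) <= B) -> on_disk a.
Proof.
  intros H. apply on_disk_of_bound. intros s Hs. exists B. intros n.
  eapply Rle_trans; [apply dilate_term_le; lra|auto].
Qed.

Lemma disk_factor_nonzero al z :
  0 <= al < 1 -> Cmod z < 1 -> (1 - RtoC al * (z * z))%C <> RtoC 0.
Proof.
  intros Hal Hz E. pose proof (Cmod_ge_0 z).
  assert (Ez : RtoC 1 = (RtoC al * (z * z))%C).
  { transitivity ((1 - RtoC al * (z * z)) + RtoC al * (z * z))%C; [ring|]. rewrite E. ring. }
  apply (f_equal Cmod) in Ez. rewrite Cmod_1, !Cmod_mult, Cmod_R, Rabs_pos_eq in Ez by lra.
  assert (Cmod z * Cmod z < 1) by nra. nra.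
Qed.

Lemma eval_even_geometric al z :
  0 <= al < 1 -> Cmod z < 1 ->
  eval (fun n => RtoC (even_geometric al n)) z = (/ (1 - RtoC al * (z * z)))%C.
Proof.
  intros Hal Hz. pose proof (disk_factor_nonzero al z Hal Hz) as Hn. set (e := fun n => RtoC (even_geometric al n)).
  assert (He : on_disk e).
  { apply bounded_on_disk with 1. intros n. unfold e.
    pose proof (even_geometric_bound al n ltac:(lra)). rewrite Cmod_R, Rabs_pos_eq; lra. }
  assert (E : eval e z = (1 + RtoC al * (z * z) * eval e z)%C).
  { rewrite (disk_eval_S e), (disk_eval_S (tail e)) at 1 by auto using on_disk_tail.
    rewrite (eval_ext (tail (tail e)) (fun n => RtoC al * e n)%C).
    - rewrite disk_eval_scal by auto. unfold tail, e at 1 2. simpl. ring.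
    - intros n. unfold tail, e. simpl. apply RtoC_mult. }
  transitivity ((eval e z - RtoC al * (z * z) * eval e z) / (1 - RtoC al * (z * z)))%C.
  - field. exact Hn.
  - rewrite E at 1. field. exact Hn.
Qed.

(** Coefficients of z (al + k z^2 / (1 - al z^2)). For k = al^2 - 1 this is
    z (al - z^2) / (1 - al z^2); the opposite k gives the absolute values of its
    coefficients, so that the majorant series is covered by the same formula. *)
Definition blaschke_series (al k : R) (n : nat) : R :=
  match n with O => 0 | 1%nat => al | 2%nat => 0 | S (S (S m)) => k * even_geometric al m end.

Lemma on_disk_blaschke al k :
  0 <= al <= 1 -> on_disk (fun n => RtoC (blaschke_series al k n)).
Proof.
  intros Hal. apply bounded_on_disk with (1 + Rabs k). intros n. rewrite Cmod_R.
  pose proof (Rabs_pos k).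
  destruct n as [|[|[|n]]]; simpl; rewrite ?Rabs_R0; try lra.
  - rewrite Rabs_pos_eq; lra.
  - pose proof (even_geometric_bound al n Hal).
    rewrite Rabs_mult, (Rabs_pos_eq (even_geometric al n)) by lra. nra.
Qed.

Lemma eval_blaschke al k z :
  0 <= al < 1 -> Cmod z < 1 ->
  eval (fun n => RtoC (blaschke_series al k n)) z
  = (z * (RtoC al + RtoC k * (z * z) / (1 - RtoC al * (z * z))))%C.
Proof.
  intros Hal Hz. set (b := fun n => RtoC (blaschke_series al k n)).
  pose proof (on_disk_blaschke al k ltac:(lra)) as Hb. fold b in Hb.
  rewrite (disk_eval_S b), (disk_eval_S (tail b)), (disk_eval_S (tail (tail b)))
    by auto using on_disk_tail.
  rewrite (eval_ext (tail (tail (tail b))) (fun n => RtoC k * RtoC (even_geometric al n))%C).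
  - rewrite disk_eval_scal, eval_even_geometric; auto.
    + unfold tail, b, Cdiv. simpl. ring.
    + apply bounded_on_disk with 1. intros n.
      pose proof (even_geometric_bound al n ltac:(lra)). rewrite Cmod_R, Rabs_pos_eq; lra.
  - intros n. unfold tail, b. simpl. apply RtoC_mult.
Qed.

Lemma disk_automorphism_le al w :
  0 <= al <= 1 -> Cmod w <= 1 -> Cmod (RtoC al - w) <= Cmod (1 - RtoC al * w).
Proof.
  intros Hal Hw. pose proof (Cmod_ge_0 w).
  assert (W : Cmod w ^ 2 <= 1) by nra. rewrite Cmod2_alt in W.
  apply Rsqr_incr_0; [|apply Cmod_ge_0|apply Cmod_ge_0].
  rewrite !Rsqr_pow2, !Cmod2_alt. destruct w as [x y].
  unfold Re, Im, Cminus, Cplus, Copp, Cmult, RtoC in *; cbn [fst snd] in *.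
  (* the two squares differ by (1 - al^2) (1 - |w|^2) *)
  assert (0 <= (1 - al * al) * (1 - (x ^ 2 + y ^ 2))) by (apply Rmult_le_pos; nra).
  nra.
Qed.

(** Lets closed forms of complex series compute majorant series. *)
Lemma majorant_as_eval a r :
  majorant_series a r = fst (eval (fun n => RtoC (Cmod (a n))) (RtoC r)).
Proof.
  unfold majorant_series, PSeries, eval; cbn [fst]. apply Series_ext. intros n.
  rewrite <- RtoC_pow, <- RtoC_mult. reflexivity.
Qed.

(** With be = (1 - r^2) / (2 r^2) < 1, the condition (1 + 2 al) r^2 > 1 reads
    al > be; the midpoint of be and 1 is taken. *)
Lemma sharpness r : 0 < r < 1 -> 1 < 3 * (r * r) ->
  exists (f g : C -> C) (a b : nat -> C),
    analytic_in_disk f a /\ analytic_in_disk g b /\ odd_in_disk f /\ odd_in_disk g /\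
    dominated_in_disk g f /\ majorant_series b r > majorant_series a r.
Proof.
  intros Hr Hr3.
  set (be := (1 - r * r) / (2 * (r * r))).
  assert (Hbe : be * (2 * (r * r)) = 1 - r * r) by (unfold be; field; nra).
  assert (Hbe1 : 0 < be < 1) by (split; nra).
  set (al := (1 + be) / 2). assert (Hal : 0 <= al < 1) by (unfold al; lra).
  assert (Hal2 : 1 < (1 + 2 * al) * (r * r)) by (unfold al; nra).
  set (k := 1 - al * al). assert (Hk : 0 <= k) by (unfold k; nra).
  set (a := linear_series 0 1). set (b := fun n => RtoC (blaschke_series al (- k) n)).
  assert (Ha : on_disk a) by (apply l1_on_disk, l1_linear).
  assert (Hb : on_disk b) by (apply on_disk_blaschke; lra).
  assert (Ea : forall z, Cmod z < 1 -> eval a z = z).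
  { intros z Hz. unfold a. rewrite eval_linear by lra. ring. }
  assert (Eb : forall z, Cmod z < 1 ->
     eval b z = (z * ((RtoC al - z * z) / (1 - RtoC al * (z * z))))%C).
  { intros z Hz. unfold b. rewrite eval_blaschke by (auto; lra).
    pose proof (disk_factor_nonzero al z Hal Hz) as Hn. f_equal.
    unfold k. rewrite RtoC_opp, RtoC_minus, RtoC_mult. field. auto. }
  exists (eval a), (eval b), a, b. repeat split.
  - apply eval_analytic, Ha.
  - apply eval_analytic, Hb.
  - intros z Hz. rewrite !Ea; auto. rewrite Cmod_opp; auto.
  - intros z Hz. rewrite !Eb; auto; [|rewrite Cmod_opp; auto].
    replace (- z * - z)%C with (z * z)%C by ring. ring.
  - intros z Hz. rewrite Ea, Eb, Cmod_mult by auto.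
    pose proof (disk_factor_nonzero al z Hal Hz) as Hn.
    pose proof (disk_automorphism_le al (z * z)%C ltac:(lra)) as D.
    rewrite Cmod_div by auto. apply Cmod_gt_0 in Hn.
    pose proof (Cmod_ge_0 z).
    rewrite <- (Rmult_1_r (Cmod z)) at 2. apply Rmult_le_compat_l; [auto|].
    apply Rle_div_l; [auto|]. rewrite Rmult_1_l. apply D. rewrite Cmod_mult. nra.
  - assert (Hz : Cmod (RtoC r) < 1) by (rewrite Cmod_R, Rabs_pos_eq; lra).
    rewrite !majorant_as_eval.
    rewrite (eval_ext (fun n => RtoC (Cmod (a n))) a).
    2:{ intros [|[|n]]; unfold a; simpl; rewrite ?Cmod_0, ?Cmod_1; reflexivity. }
    rewrite (eval_ext (fun n => RtoC (Cmod (b n))) (fun n => RtoC (blaschke_series al k n))).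
    2:{ intros n. unfold b. f_equal. rewrite Cmod_R. destruct n as [|[|[|n]]]; simpl.
        - apply Rabs_R0.
        - apply Rabs_pos_eq; lra.
        - apply Rabs_R0.
        - pose proof (even_geometric_bound al n ltac:(lra)).
          rewrite Ropp_mult_distr_l_reverse, Rabs_Ropp. apply Rabs_pos_eq. nra. }
    rewrite Ea, eval_blaschke by (auto; lra).
    assert (Pd : 0 < 1 - al * (r * r)) by nra.
    replace (1 - RtoC al * (RtoC r * RtoC r))%C with (RtoC (1 - al * (r * r)))
      by (rewrite RtoC_minus, !RtoC_mult; reflexivity).
    rewrite <- !RtoC_mult, <- RtoC_div, <- RtoC_plus, <- RtoC_mult by lra. cbn [fst RtoC].
    assert (1 < al + k * (r * r) / (1 - al * (r * r))); [|nra].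
    apply Rmult_lt_reg_r with (1 - al * (r * r)); [auto|].
    unfold Rdiv. rewrite Rmult_plus_distr_r, Rmult_assoc, Rinv_l by lra. unfold k. nra.
Qed.

Theorem theorem3 :
  (forall (f g : C -> C) (a b : nat -> C),
     analytic_in_disk f a -> analytic_in_disk g b ->
     odd_in_disk f -> odd_in_disk g ->
     dominated_in_disk g f ->
     forall r : R, 0 <= r <= 1 / sqrt 3 -> majorant_series b r <= majorant_series a r) /\
  (forall r : R, 1 / sqrt 3 < r < 1 ->
     exists (f g : C -> C) (a b : nat -> C),
       analytic_in_disk f a /\ analytic_in_disk g b /\
       odd_in_disk f /\ odd_in_disk g /\
       dominated_in_disk g f /\
       majorant_series b r > majorant_series a r).
Proof.
  assert (Q : 0 < 1 / sqrt 3) by (apply Rdiv_lt_0_compat; [lra|apply sqrt_lt_R0; lra]).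
  assert (Q2 : (1 / sqrt 3) * (1 / sqrt 3) = 1 / 3).
  { pose proof (sqrt_sqrt 3 ltac:(lra)) as H3. pose proof (sqrt_lt_R0 3 ltac:(lra)).
    rewrite <- H3 at 3. field. lra. }
  split.
  - intros f g a b Hf Hg Of Og Hd r Hr. apply (odd_majorant_le f g); auto; [lra|].
    rewrite <- Q2. apply Rmult_le_compat; lra.
  - intros r Hr. apply sharpness; [lra|].
    assert ((1 / sqrt 3) * (1 / sqrt 3) < r * r) by (apply Rmult_le_0_lt_compat; lra). lra.
Qed.
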